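(* Assume that $1/2<\delta<1$. Then there exists a random vector $L\in\mathbf{R}^d$ such that $$\lim_{n\to\infty}\frac{S_n}{n^\delta}=L\quad\text{a.s. and in } L^2.$$ Furthermore, $$\boldsymbol{E}[L]=0,\qquad \boldsymbol{E}[|L|^2]=C_{\alpha,\beta},$$ where $C_{\alpha,\beta}$ is the positive constant such that $\boldsymbol{E}[|S_n-\boldsymbol{E}[S_n]|^2]\sim C_{\alpha,\beta}\,n^{2\delta}$ as $n\to\infty$. In particular, $L$ is not constant.
   Context: Setting. Let $d\ge 1$ and let $\mathcal{S}_{\mathfrak{e}},\mathcal{S}_{\mathfrak{o}},V_{\mathfrak{e}},V_{\mathfrak{o}}\subset\mathbf{R}^d$, with $V_{\mathfrak{o}},V_{\mathfrak{e}}$ finite, satisfy: (1) $x+v\in\mathcal{S}_{\mathfrak{o}}$ for $x\in\mathcal{S}_{\mathfrak{e}}$, $v\in V_{\mathfrak{o}}$; (2) $x+v\in\mathcal{S}_{\mathfrak{e}}$ for $x\in\mathcal{S}_{\mathfrak{o}}$, $v\in V_{\mathfrak{e}}$; (3) $V_{\mathfrak{o}}=-V_{\mathfrak{e}}$; (4) $0\in\mathcal{S}_{\mathfrak{e}}$; (5) $V_{\mathfrak{o}}\cap V_{\mathfrak{e}}=\emptyset$. Put $V=V_{\mathfrak{o}}\cup V_{\mathfrak{e}}$, let $m$ be the common cardinality of $V_{\mathfrak{o}}$ and $V_{\mathfrak{e}}$, and assume $m\ge2$. Fix $p,q\in[0,1]$ and set $\alpha=\frac{mp-1}{m-1}$,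 $\beta=\frac{mq-1}{m-1}$, $\delta=\frac12(\alpha-\beta)$. For each $k\ge2$ and $v\in V$ let $G_k(v)$ be a random variable with values in $V_{\mathfrak{o}}$ if $k$ is odd and in $V_{\mathfrak{e}}$ if $k$ is even, with the following law. Let $W$ denote $V_{\mathfrak{o}}$ if $k$ is odd and $V_{\mathfrak{e}}$ if $k$ is even, and let $w\in W$. If $v\in W$, then $\boldsymbol{P}(G_k(v)=w)=p$ for $w=v$ and $\frac{1-p}{m-1}$ for $w\ne v$. If $v\in V\setminus W$ (so $-v\in W$), then $\boldsymbol{P}(G_k(v)=w)=q$ for $w=-v$ and $\frac{1-q}{m-1}$ for $w\neq -v$. Let $X_1$ be uniform on $V_{\mathfrak{o}}$ and, for $n\ge1$, let $\mathcal{U}_n$ be uniform on $\{1,\dots,n\}$. The $\sigma$-fields $\sigma(X_1),\ \sigma(\mathcal{U}_1,\{G_2(v)\}_{v\in V}),\ \sigma(\mathcal{U}_2,\{G_3(v)\}_{v\in V}),\dots$ are independent, and for each $n\ge1$, $\mathcal{U}_n$ is independent of $\{G_{n+1}(v)\}_{v\in V}$. Define, for $n\geq 1$, $X_{n+1}=G_{n+1}(X_{\mathcal{U}_n})$; and $S_0=0$, $S_{n+1}=S_n+X_{n+1}$ for $n\ge0$ (the elephant random walk). $a_n\sim b_n$ means $a_n/b_n\to1$; $|\cdot|$ is the Euclidean norm. The existence and positivity of $C_{\alpha,\beta}$ for $1/2<\delta<1$ is part of the paper's second-moment theorem (the constant also depends on $V_{\mathfrak{o}},V_{\mathfrak{e}}$).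 *)

(* Defs.v *)
From HB Require Import structures.
From mathcomp Require Import all_boot all_order all_algebra finmap.
From mathcomp Require Import all_classical all_reals all_analysis.

Set Implicit Arguments.
Unset Strict Implicit.
Unset Printing Implicit Defensive.

Import Order.TTheory GRing.Theory Num.Theory.
Import numFieldNormedType.Exports.

Local Open Scope classical_set_scope.
Local Open Scope ring_scope.

Section euclidean.
Context {R : realType} {d : nat}.

(* The library norm on 'rV[R]_d is the sup norm. *)
Definition enorm (x : 'rV[R]_d) : R := Num.sqrt (\sum_(i < d) x ord0 i ^+ 2).

Definition vborel : set (set 'rV[R]_d) := <<s open >>.

End euclidean.

Section probability.
Context {R : realType} {disp : measure_display} {Omega : measurableType disp}.

Definition random_vector d (Z : Omega -> 'rV[R]_d) : Prop :=
  forall B, vborel B -> measurable (Z @^-1` B).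

(* The coordinates are passed through [fine], so this is meaningful only when
   they are integrable (it is used for bounded random vectors). *)
Definition vexpectation (P : probability Omega R) d (Z : Omega -> 'rV[R]_d) :
  'rV[R]_d := \row_i fine ('E_P[fun w => Z w ord0 i])%E.

Definition second_moment (P : probability Omega R) d (Z : Omega -> 'rV[R]_d) :
  \bar R := ('E_P[fun w => (enorm (Z w) ^+ 2)%R])%E.

(* sigma-field generated by Z, the target being equipped with the
   sigma-field G *)
Definition sigma_of (T : Type) (G : set (set T)) (Z : Omega -> T) :
  set (set Omega) := preimage_set_system setT Z G.

Definition mutually_independent (P : probability Omega R) (I : choiceType)
    (F : I -> set (set Omega)) : Prop :=
  forall (J : {fset I}) (A : I -> set Omega),
    (forall i, i \in J -> F i (A i)) ->
    P (\bigcap_(i in [set` J]) A i) = (\prod_(i <- J) P (A i))%E.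

Definition independent2 (P : probability Omega R)
    (F1 F2 : set (set Omega)) : Prop :=
  forall A B, F1 A -> F2 B -> P (A `&` B) = (P A * P B)%E.

End probability.

Definition asymp_equiv {R : realType} (a b : nat -> R) : Prop :=
  (fun n => a n / b n) @ \oo --> (1 : R).

Section elephant.
Context {R : realType} {d : nat}.
Implicit Types (Vo Ve : {fset 'rV[R]_d}) (v w : 'rV[R]_d).

Record step_structure (Se So : set 'rV[R]_d) Vo Ve : Prop := StepStructure {
  step_Se : forall x v, Se x -> v \in Vo -> So (x + v);
  step_So : forall x v, So x -> v \in Ve -> Se (x + v);
  step_opp : Vo = [fset - v | v in Ve]%fset;
  step_origin : Se 0;
  step_disjoint : (Vo `&` Ve)%fset = fset0
}.

Definition parity_steps Vo Ve (k : nat) : {fset 'rV[R]_d} :=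
  if odd k then Vo else Ve.

Definition elephant_alpha (m : nat) (p : R) : R := (m%:R * p - 1) / (m%:R - 1).

Definition elephant_beta (m : nat) (q : R) : R := (m%:R * q - 1) / (m%:R - 1).

Definition elephant_delta (m : nat) (p q : R) : R :=
  (elephant_alpha m p - elephant_beta m q) / 2.

(* P(G_k(v) = w) for v in Vo `|` Ve and w in parity_steps Vo Ve k *)
Definition step_law (m : nat) Vo Ve (p q : R) (k : nat) v w : R :=
  if v \in parity_steps Vo Ve k then
    if w == v then p else (1 - p) / (m%:R - 1)
  else
    if w == - v then q else (1 - q) / (m%:R - 1).

Section walk.
Context {disp : measure_display} {Omega : measurableType disp}.
Implicit Types (X : nat -> Omega -> 'rV[R]_d) (U : nat -> Omega -> nat)
  (G : nat -> 'rV[R]_d -> Omega -> 'rV[R]_d).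

Definition sigma_steps Vo Ve G (k : nat) : set (set Omega) :=
  <<s \bigcup_(v in [set` (Vo `|` Ve)%fset]) sigma_of vborel (G k v) >>.

Definition sigma_memory U (n : nat) : set (set Omega) :=
  sigma_of [set: set nat] (U n).

(* sigma(X_1), sigma(U_1, (G_2(v))_v), sigma(U_2, (G_3(v))_v), etc *)
Definition innovation Vo Ve X U G (n : nat) : set (set Omega) :=
  if n is 0%N then sigma_of vborel (X 1%N)
  else <<s sigma_memory U n `|` sigma_steps Vo Ve G n.+1 >>.

(* The values X 0, U 0, G 0, G 1, and G k v for v outside Vo `|` Ve are
   irrelevant and left unconstrained. *)
Record elephant_walk (P : probability Omega R) (m : nat) Vo Ve (p q : R)
    X U G : Prop := ElephantWalk {
  erw_G_rv : forall k v, (2 <= k)%N -> v \in (Vo `|` Ve)%fset ->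
    random_vector (G k v);
  erw_G_val : forall k v x, (2 <= k)%N -> v \in (Vo `|` Ve)%fset ->
    G k v x \in parity_steps Vo Ve k;
  erw_G_law : forall k v w, (2 <= k)%N -> v \in (Vo `|` Ve)%fset ->
    w \in parity_steps Vo Ve k ->
    P [set x | G k v x = w] = (step_law m Vo Ve p q k v w)%:E;
  erw_X1_rv : random_vector (X 1%N);
  erw_X1_val : forall x, X 1%N x \in Vo;
  erw_X1_law : forall w, w \in Vo -> P [set x | X 1%N x = w] = (m%:R^-1)%:E;
  erw_U_rv : forall n, (1 <= n)%N -> measurable_fun [set: Omega] (U n);
  erw_U_val : forall n x, (1 <= n)%N -> (1 <= U n x <= n)%N;
  erw_U_law : forall n k, (1 <= k <= n)%N ->
    P [set x | U n x = k] = (n%:R^-1)%:E;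
  erw_indep : mutually_independent P (innovation Vo Ve X U G);
  erw_indep_UG : forall n, (1 <= n)%N ->
    independent2 P (sigma_memory U n) (sigma_steps Vo Ve G n.+1);
  erw_step : forall n x, (1 <= n)%N -> X n.+1 x = G n.+1 (X (U n x) x) x
}.

Fixpoint position X (n : nat) (x : Omega) : 'rV[R]_d :=
  if n is n'.+1 then position X n' x + X n'.+1 x else 0.

End walk.
End elephant.

(* Main.v *)
Require Import Defs.
From HB Require Import structures.
From mathcomp Require Import all_boot all_order all_algebra finmap.
From mathcomp Require Import all_classical all_reals all_analysis.
From mathcomp Require Import measurable_realfun ring lra.

Set Implicit Arguments.
Unset Strict Implicit.
Unset Printing Implicit Defensive.

Import Order.TTheory GRing.Theory Num.Theory.
Import numFieldNormedType.Exports.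

Local Open Scope classical_set_scope.
Local Open Scope ring_scope.

(** Every coordinate of the walk is, up to a bounded deterministic term, the sum
   T of the centred steps psi(X_1), ..., psi(X_n), where psi is an odd function
   on V of mean zero on V_o. Let D be the same sum with the sign of psi(X_k)
   reversed at even times. A remembered step only matters through its
   representative in the current step set ([kernelE]), so the next centred step
   has conditional mean (delta T + (-1)^n gamma D) / n with
   gamma = (alpha + beta) / 2 ([next_mean_psi]). The first term makes T grow like
   n^delta. The second one changes sign at every step, so that it cancels, up to
   a lower order, over two successive steps: the corrected process
      Z_n = n^-delta (T_n + (-1)^n gamma / (2 n) D_n)
   has conditional drift O(n^(-1-delta)), uniformly over all histories
   ([remainder_bound]), because T_n and D_n are at most a constant times n.

   Therefore Z is a martingale plus a compensator whose tail after time n is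
   O(n^-delta), and the martingale has increments O(n^-delta), which are square
   summable because delta > 1/2. With a maximal inequality ([hexp_maximal]) this
   makes Z converge almost surely and in mean square, and S_n / n^delta differs
   from the vector of the Z's by O(n^-delta).

   The law of the past is explicit: given the first n steps, the next one has the
   law [next_law]. Iterating the corresponding averaging operator [cexp] from the
   empty history computes the expectation of any function of the first n steps
   ([expectation_hist]). All moments of the walk are thus fixed by V_o, V_e, m, p
   and q, and so is the constant C, the sum over the coordinates of the limits of
   the second moments of Z ([limit_constant]). The passage from the probability
   space to [cexp] uses the independence assumption only for events about single
   values of the memories and of the choices, through the class [past].

   C is positive because after time n the martingale still gains an energy of
   order n^(1-2delta), while the square of the compensator is only O(n^(-2delta))
   ([limit_variance_ge]). The energy is bounded below because every step is
   uniform ([hexp_sum_next]) and the squared drift has expectation at most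
   delta + 1/(2n) < 1 times the variance of a step ([drift_sqr_le]). *)

(** * Negative powers of n *)

Section real_powers.
Context {R : realType}.
Implicit Types (r u : R) (n : nat).

(** Young's inequality for the product of (1 + u)^r and 1. *)
Lemma powR_le_tangent r u : 0 < r < 1 -> 0 <= u -> (1 + u) `^ r <= 1 + r * u.
Proof.
move=> /andP[r0 r1] u0.
have := @conjugate_powR R ((1 + u) `^ r) 1 r^-1 (1 - r)^-1 (powR_ge0 _ _) ler01.
rewrite !invr_gt0 !invrK => /(_ r0); rewrite subr_gt0 => /(_ r1).
have -> : r + (1 - r) = 1 by ring.
move=> /(_ erefl); rewrite mulr1 -powRrM mulfV ?gt_eqF//.
rewrite powRr1; last by rewrite addr_ge0.
by rewrite powR1 /=; lra.
Qed.

(** The previous bound for the exponent 1 - r, multiplied by (1 + u)^r. Together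
   the two bounds give (1 + u)^r up to O(u^2), which replaces all calculus on
   powers below. *)
Lemma powR_ge_secant r u :
  0 < r < 1 -> 0 <= u -> 1 + u <= (1 + u) `^ r * (1 + (1 - r) * u).
Proof.
move=> /andP[r0 r1] u0.
have r1' : 0 < 1 - r < 1 by lra.
have := powR_le_tangent r1' u0.
have u1 : 0 < 1 + u by lra.
rewrite -(ler_pM2l (powR_gt0 r u1)) -powRD; last by rewrite (gt_eqF u1) implybT.
have -> : r + (1 - r) = 1 by ring.
by rewrite powRr1// ltW.
Qed.

Definition decay r n : R := n%:R `^ (- r).

Lemma decay_gt0 r n : (0 < n)%N -> 0 < decay r n.
Proof. by move=> n0; rewrite powR_gt0// ltr0n. Qed.

Lemma decayS r n : (0 < n)%N ->
  decay r n = decay r n.+1 * (1 + n%:R^-1) `^ r.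
Proof.
move=> n0; have n0R : 0 < n%:R :> R by rewrite ltr0n.
rewrite /decay !powRN.
have -> : n.+1%:R = n%:R * (1 + n%:R^-1) :> R.
  by rewrite mulrDr mulr1 mulfV ?gt_eqF// -natr1.
have u0 : 0 < 1 + n%:R^-1 :> R by rewrite addr_gt0// invr_gt0.
by rewrite powRM ?(ltW u0)// ?invfM mulfVK// gt_eqF// powR_gt0.
Qed.

Lemma decay_ratio_le r n : 0 < r < 1 -> (0 < n)%N ->
  decay r n <= decay r n.+1 * (1 + r * n%:R^-1).
Proof.
by move=> r01 n0; rewrite decayS// ler_pM2l ?decay_gt0// powR_le_tangent// invr_ge0.
Qed.

Lemma decay_ratio_ge r n : 0 < r < 1 -> (0 < n)%N ->
  decay r n.+1 * (1 + n%:R^-1) <= decay r n * (1 + (1 - r) * n%:R^-1).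
Proof.
move=> r01 n0; rewrite (decayS r n0) -mulrA ler_pM2l ?decay_gt0//.
by rewrite powR_ge_secant.
Qed.

Lemma decayS_le r n : 0 < r < 1 -> (0 < n)%N -> decay r n.+1 <= decay r n.
Proof.
move=> r01 n0; have h := decay_ratio_ge r01 n0.
have u0 : 0 <= n%:R^-1 :> R by rewrite invr_ge0.
have x0 := decay_gt0 r n0; case/andP: r01 => r0 r1.
have u1 : 0 < 1 + n%:R^-1 :> R by lra.
rewrite -(ler_pM2r u1); apply: (le_trans h).
by rewrite ler_pM2l// lerD2l ler_piMl//; lra.
Qed.

(** A summand n^(-r-1) is dominated by a telescoping one; this is how the tails of
   the two series of the proof are bounded. *)
Lemma decayS_tail r n : 0 < r < 1 -> (0 < n)%N ->
  r / 2 * (decay r n * n%:R^-1) <= 2 * (decay r n - decay r n.+1).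
Proof.
move=> r01 n0; have := decay_ratio_ge r01 n0.
have /andP[r0 r1] := r01.
have u0 : 0 <= n%:R^-1 :> R by rewrite invr_ge0.
have u1 : n%:R^-1 <= 1 :> R by rewrite invf_le1 ?ler1n ?ltr0n.
have := decayS_le r01 n0.
have := decay_gt0 r n0; have := @decay_gt0 r n.+1 isT.
move: (decay r n) (decay r n.+1) (n%:R^-1) u0 u1 => x y u u0 u1 y0 x0 yx h.
have : (x - y) * (1 + u) >= r * x * u by lra.
have : (x - y) * (1 + u) <= (x - y) * 2 by rewrite ler_wpM2l; lra.
have : 0 <= r * x * u by rewrite !mulr_ge0; lra.
lra.
Qed.

(** The converse comparison, which bounds from below the energy that the
   martingale still has to gain. *)
Lemma decayS_diff r n : 0 < r < 1 -> (0 < n)%N ->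
  decay r n - decay r n.+1 <= decay r n * n%:R^-1.
Proof.
move=> r01 n0; have := decay_ratio_le r01 n0.
have u0 : 0 <= n%:R^-1 :> R by rewrite invr_ge0.
have := decayS_le r01 n0; case/andP: r01 => r0 r1.
have := decay_gt0 r n0; have := @decay_gt0 r n.+1 isT.
move: (decay r n) (decay r n.+1) (n%:R^-1) u0 => x y u u0 y0 x0 yx h.
have : y * (r * u) <= x * (1 * u).
  by apply: ler_pM => //; [lra | rewrite mulr_ge0//; lra | rewrite ler_wpM2r//; lra].
lra.
Qed.

Lemma decay_cvg0 r : 0 < r -> decay r n @[n --> \oo] --> 0.
Proof.
move=> r0; apply/cvgrPdist_le => e e0.
near=> n.
rewrite sub0r normrN ger0_norm ?powR_ge0// /decay powRN.
have n0 : (0 < n)%N by near: n; exists 1%N.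
rewrite invf_ple ?posrE// ?powR_gt0 ?ltr0n//.
have en : (e^-1) `^ r^-1 <= n%:R by near: n; exact: nbhs_infty_ger.
have := @ge0_ler_powR R r (ltW r0) _ _ _ _ en.
rewrite -powRrM mulVf ?gt_eqF// powRr1 ?invr_ge0; last exact: ltW.
apply.
  by rewrite nnegrE powR_ge0.
by rewrite nnegrE ler0n.
Unshelve. all: by end_near. Qed.

Lemma decayD r s n : (0 < n)%N -> decay (r + s) n = decay r n * decay s n.
Proof.
move=> n0; rewrite /decay opprD powRD// (gt_eqF (_ : 0 < n%:R)) ?implybT//.
by rewrite ltr0n.
Qed.

Lemma decay1 n : (0 < n)%N -> decay 1 n = n%:R^-1.
Proof. by move=> n0; rewrite /decay powR_inv1. Qed.

End real_powers.

(** * The two coefficients of the one-step drift *)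

(** Here s and s' stand for n^-delta and (n+1)^-delta, u and u' for 1/n and
   1/(n+1). The bounds say that the coefficients of T and of (-1)^n D in the
   drift of the corrected process are O(n^(-2-delta)). *)
Section one_step_estimates.
Context {R : realType} {dlt gam s s' u u' : R}.
Hypotheses (d0 : 0 < dlt) (d1 : dlt < 1) (g0 : -1 <= gam) (g1 : gam <= 1).
Hypotheses (s0 : 0 < s) (u'0 : 0 <= u') (u'u : u' <= u) (u1 : u <= 1).
Hypotheses (uu : u - u' <= u * u) (sd : s - s' <= s * u) (sle : s' <= s).
Hypotheses (sge : s' * (1 + u) <= s * (1 + (1 - dlt) * u)).
Hypotheses (sgle : s <= s' * (1 + dlt * u)).

Let u0 : 0 <= u. Proof. exact: le_trans u'u. Qed.

Let s'0 : 0 <= s'.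
Proof.
have := le_trans (ltW s0) sgle; rewrite pmulr_lge0// ltr_pwDl//.
by rewrite mulr_ge0// ltW.
Qed.

Let cubic_ge0 : 0 <= s' * u' * u. Proof. by rewrite !mulr_ge0. Qed.

Let cubic_le : s' * u' * u <= s * u * u.
Proof. by rewrite ler_wpM2r// ler_pM. Qed.

Lemma plain_coef_bound :
  `|s' * (1 + (1 - gam / 2 * u') * (dlt * u)) - s| <= 2 * (s * u * u).
Proof.
have [D0 D1 G0 G1] : [/\ 0 < dlt, dlt < 1, -1 <= gam & gam <= 1] by [].
have suu : 0 <= s * u * u by rewrite !mulr_ge0// ltW.
have e1 : 0 <= s' * (1 + dlt * u) - s <= s * u * u.
  have X0 : 0 <= s' * (1 + dlt * u) - s by rewrite subr_ge0.
  (* after multiplication by 1 + u, the bound on s' (1 + u) leaves only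
     dlt (1 - dlt) s u^2 *)
  rewrite X0 /=; apply: (@le_trans _ _ ((s' * (1 + dlt * u) - s) * (1 + u))).
    by rewrite ler_peMr// lerDl.
  have : s' * (1 + u) * (1 + dlt * u) <=
         s * (1 + (1 - dlt) * u) * (1 + dlt * u).
    by rewrite ler_wpM2r// addr_ge0// mulr_ge0// ltW.
  have : dlt * (1 - dlt) * (s * u * u) <= 1 * (s * u * u).
    by rewrite ler_wpM2r// mulr_ile1//; lra.
  lra.
have -> : s' * (1 + (1 - gam / 2 * u') * (dlt * u)) - s =
    (s' * (1 + dlt * u) - s) - gam / 2 * dlt * (s' * u' * u) by ring.
have : `|gam / 2 * dlt * (s' * u' * u)| <= 1 * (s * u * u).
  rewrite normrM (ger0_norm cubic_ge0); apply: ler_pM => //.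
  by rewrite normrM mulr_ile1// ler_norml; apply/andP; split; lra.
by rewrite !ler_norml => /andP[? ?]; apply/andP; split; lra.
Qed.

(** The choice gam / (2 n) of the correction: gam u - gam u' / 2, from the new
   drift and from the change of sign of the correction, is gam u / 2 up to
   O(u^2), and the old correction cancels this. *)
Lemma alternating_coef_bound :
  `|s' * (gam * u - gam / 2 * u' - gam / 2 * u' * (gam * u)) - s * (gam / 2 * u)|
    <= 2 * (s * u * u).
Proof.
have [G0 G1] : -1 <= gam /\ gam <= 1 by [].
have -> : s' * (gam * u - gam / 2 * u' - gam / 2 * u' * (gam * u)) -
    s * (gam / 2 * u) =
    gam / 2 * (s' * (u - u') - (s - s') * u) - gam ^+ 2 / 2 * (s' * u' * u).
  by field.
have q1 : 0 <= s' * (u - u') <= s * u * u.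
  by rewrite -mulrA mulr_ge0 ?subr_ge0//=; apply: ler_pM => //; rewrite subr_ge0.
have q2 : 0 <= (s - s') * u <= s * u * u.
  by rewrite mulr_ge0 ?subr_ge0//= ler_wpM2r.
have h1 : `|gam / 2 * (s' * (u - u') - (s - s') * u)| <= 1 * (s * u * u).
  case/andP: q1 => q11 q12; case/andP: q2 => q21 q22.
  by rewrite normrM; apply: ler_pM => //; rewrite ler_norml; apply/andP; split; lra.
have h2 : `|gam ^+ 2 / 2 * (s' * u' * u)| <= 1 * (s * u * u).
  rewrite normrM (ger0_norm cubic_ge0); apply: ler_pM => //.
  have : `|gam * (gam / 2)| <= 1.
    by rewrite normrM mulr_ile1// ler_norml; apply/andP; split; lra.
  by rewrite mulrA expr2.
by rewrite (le_trans (ler_normB _ _))//; lra.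
Qed.

End one_step_estimates.

(** * Young's inequality and square roots *)

Section triangle.
Context {R : realType}.

Lemma sqr_young (a b t : R) : 0 < t ->
  a ^+ 2 <= (1 + t) * b ^+ 2 + (1 + t^-1) * (a - b) ^+ 2.
Proof.
move=> t0; rewrite -subr_ge0.
suff -> : (1 + t) * b ^+ 2 + (1 + t^-1) * (a - b) ^+ 2 - a ^+ 2 =
    t^-1 * (t * b - (a - b)) ^+ 2.
  by rewrite mulr_ge0 ?sqr_ge0// invr_ge0 ltW.
by field; rewrite gt_eqF.
Qed.

(** Optimising a weighted Young inequality over its weight gives the triangle
   inequality for the square roots. With [sqr_young] this yields Minkowski's
   inequality for any positive linear functional, in particular for averages over
   histories and for expectations. *)
Lemma sqrt_triangle (a c e : R) : 0 <= c -> 0 <= e ->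
  (forall t, 0 < t -> a <= (1 + t) * c + (1 + t^-1) * e) ->
  Num.sqrt a <= Num.sqrt c + Num.sqrt e.
Proof.
move=> c0 e0 h; apply/ler_addgt0Pr => s s0.
have := sqr_sqrtr c0; have := sqr_sqrtr e0; have := sqrtr_ge0 c.
have := sqrtr_ge0 e; move: (Num.sqrt c) (Num.sqrt e) => x y y0 x0 ye xc.
(* the optimal weight is y / x; the shift by s / 2 keeps it positive and finite *)
have {h} := h ((y + s / 2) / (x + s / 2)).
have -> : x + y + s = (x + s / 2) + (y + s / 2) by field.
have : 0 < x + s / 2 by lra.
have : 0 < y + s / 2 by lra.
have : c <= (x + s / 2) ^+ 2 by rewrite -xc; nra.
have : e <= (y + s / 2) ^+ 2 by rewrite -ye; nra.
move: (x + _) (y + _) => {}x {}y {}ye {}xc {}y0 {}x0.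
have t0 : 0 < y / x by rewrite divr_gt0.
move=> /(_ t0) h.
have {}h : a <= (x + y) ^+ 2.
  apply: (le_trans h).
  apply: (@le_trans _ _ ((1 + y / x) * x ^+ 2 + (1 + (y / x)^-1) * y ^+ 2)).
    by apply: lerD; rewrite ler_wpM2l// ?addr_ge0// ?invr_ge0 ltW.
  rewrite le_eqVlt; apply/orP; left; apply/eqP; field.
  by rewrite !gt_eqF.
by apply: (le_trans (ler_wsqrtr h)); rewrite sqrtr_sqr ger0_norm; lra.
Qed.

Lemma sqrt_cvg0 (u : nat -> R) : u n @[n --> \oo] --> 0 ->
  Num.sqrt (u n) @[n --> \oo] --> 0.
Proof.
move=> u0; rewrite -[X in _ --> X]sqrtr0.
by apply: (continuous_cvg _ _ u0); exact: sqrt_continuous.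
Qed.

End triangle.

(** * Averaging over histories *)

Section history.
Context {R : realType} {d : nat}.
Variables (Vo Ve : {fset 'rV[R]_d}) (m : nat) (p q : R).
Local Notation V := 'rV[R]_d.
Local Notation W := (parity_steps Vo Ve).
Implicit Types (h : seq V) (f : V -> R) (g : seq V -> R) (k n : nat) (v w : V).

(** A history lists the steps made so far, the latest one first. The first step is
   uniform, and a later one repeats a uniformly chosen past step according to the
   step law. *)
Definition next_law h w : R :=
  if h is [::] then m%:R^-1
  else (size h)%:R^-1 * \sum_(v <- h) step_law m Vo Ve p q (size h).+1 v w.

Definition next_mean h f : R := \sum_(w <- W (size h).+1) next_law h w * f w.

Definition cexp g h : R := next_mean h (fun w => g (w :: h)).

(** Expectation of a function of the first n steps, as an iteration of one-step
   conditional expectations starting from the empty history. *)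
Definition hexp n g : R := iter n cexp g [::].

(** The histories that can occur: steps alternate between the two step sets. *)
Fixpoint valid h : bool :=
  if h is w :: h' then (w \in W (size h').+1) && valid h' else true.

Definition kernel k v f : R := \sum_(w <- W k) step_law m Vo Ve p q k v w * f w.

Definition avg (A : {fset V}) f : R := m%:R^-1 * \sum_(w <- A) f w.

(** The latest step is the head, so dropping a prefix goes back in time. *)
Definition trunc n h := drop (size h - n) h.

(** The suffixes of a history are its past states, so this says that the walk has
   met [A] at a time between n and the present. *)
Fixpoint visited n (A : pred (seq V)) h : bool :=
  (n <= size h)%N && A h || (if h is _ :: h' then visited n A h' else false).

Lemma next_meanD h f1 f2 :
  next_mean h (fun w => f1 w + f2 w) = next_mean h f1 + next_mean h f2.
Proof. by rewrite -big_split; apply: eq_bigr => w _; rewrite mulrDr. Qed.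

Lemma next_meanZ h a f : next_mean h (fun w => a * f w) = a * next_mean h f.
Proof. by rewrite mulr_sumr; apply: eq_bigr => w _; rewrite mulrCA. Qed.

Lemma eq_next_mean h f1 f2 : {in W (size h).+1, f1 =1 f2} ->
  next_mean h f1 = next_mean h f2.
Proof.
by move=> e; rewrite /next_mean [LHS]big_seq [RHS]big_seq; apply: eq_bigr => w /e ->.
Qed.

Lemma next_mean_kernel h f : h != [::] ->
  next_mean h f = (size h)%:R^-1 * \sum_(v <- h) kernel (size h).+1 v f.
Proof.
case: h => // v0 h _; rewrite /kernel exchange_big /= mulr_sumr.
by apply: eq_bigr => w _; rewrite -mulrA mulr_suml.
Qed.

Lemma hexpS n g : hexp n.+1 g = hexp n (cexp g).
Proof. by rewrite /hexp iterSr. Qed.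

Lemma hexpD n g1 g2 : hexp n (fun h => g1 h + g2 h) = hexp n g1 + hexp n g2.
Proof.
elim: n g1 g2 => // n IH g1 g2; rewrite !hexpS -IH; congr hexp.
by apply/funext => h; rewrite /cexp next_meanD.
Qed.

Lemma hexpZ n a g : hexp n (fun h => a * g h) = a * hexp n g.
Proof.
elim: n g => // n IH g; rewrite !hexpS -IH; congr hexp.
by apply/funext => h; rewrite /cexp next_meanZ.
Qed.

Lemma eq_hexp n g1 g2 :
  (forall h, valid h -> size h = n -> g1 h = g2 h) -> hexp n g1 = hexp n g2.
Proof.
elim: n g1 g2 => [|n IH] g1 g2 e; first exact: e.
rewrite !hexpS; apply: IH => h vh sh; apply: eq_next_mean => w wW.
by apply: e; rewrite /= ?wW ?sh.
Qed.

Hypotheses (VoE : Vo = [fset - v | v in Ve]%fset) (Voe : (Vo `&` Ve)%fset = fset0).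
Hypotheses (cVo : #|` Vo| = m) (cVe : #|` Ve| = m) (m2 : (2 <= m)%N).
Hypotheses (hp : 0 <= p <= 1) (hq : 0 <= q <= 1).

Let alpha := elephant_alpha m p.
Let beta := elephant_beta m q.

Lemma m_gt1 : 1 < m%:R :> R. Proof. by rewrite ltr1n. Qed.

Lemma card_W k : size (W k) = m.
Proof. by rewrite /parity_steps; case: ifP. Qed.

Lemma opp_Ve v : (- v \in Ve) = (v \in Vo).
Proof.
rewrite VoE; apply/idP/imfsetP => [h|[x xV ->]]; last by rewrite opprK.
by exists (- v) => //; rewrite opprK.
Qed.

Lemma opp_Vo v : (- v \in Vo) = (v \in Ve).
Proof. by rewrite -opp_Ve opprK. Qed.

Lemma Ve_notin_Vo v : v \in Ve -> v \in Vo = false.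
Proof.
move=> vE; apply/negP => vO.
have : v \in (Vo `&` Ve)%fset by rewrite inE vO vE.
by rewrite Voe inE.
Qed.

Lemma sum_opp f : \sum_(w <- Vo) f (- w) = \sum_(w <- Ve) f w.
Proof.
rewrite VoE big_imfset /=; last by move=> x y _ _ /oppr_inj.
by apply: eq_bigr => w _; rewrite opprK.
Qed.

(** The element of the current step set favoured by the remembered step [v]: the
   step itself or its opposite. *)
Definition twist k v : V := if v \in W k then v else - v.
Definition memory_coef k v : R := if v \in W k then alpha else beta.

Lemma twist_in k v : v \in Vo \/ v \in Ve -> twist k v \in W k.
Proof.
rewrite /twist; case: ifP => //; rewrite /parity_steps; case: (odd k) => vW [] h.
- by rewrite h in vW.
- by rewrite opp_Vo.
- by rewrite opp_Ve.
- by rewrite h in vW.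
Qed.

(** The law of a step is uniform except for the weight of one favoured element, so
   it is the mixture of a point mass and of the uniform law; the weight of the
   point mass is alpha or beta, possibly negative. *)
Lemma kernelE k v f : v \in Vo \/ v \in Ve ->
  kernel k v f = memory_coef k v * f (twist k v)
                 + (1 - memory_coef k v) * avg (W k) f.
Proof.
move=> hv; have tW := twist_in k hv.
have m1 := m_gt1.
have key (a : R) x : x \in W k ->
    \sum_(w <- W k) (if w == x then a else (1 - a) / (m%:R - 1)) * f w =
    (m%:R * a - 1) / (m%:R - 1) * f x +
    (1 - (m%:R * a - 1) / (m%:R - 1)) * avg (W k) f.
  move=> xW.
  have -> : \sum_(w <- W k) (if w == x then a else (1 - a) / (m%:R - 1)) * f w =
     (1 - a) / (m%:R - 1) * \sum_(w <- W k) f w + (a - (1 - a) / (m%:R - 1)) * f x.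
    rewrite [LHS](big_fsetD1 x)//= [X in _ = _ * X + _](big_fsetD1 x)//= eqxx.
    rewrite (_ : \sum_(_ <- (_ `\ x)%fset) _ =
        (1 - a) / (m%:R - 1) * \sum_(w <- (W k `\ x)%fset) f w).
      by move: (\sum_(i <- _) _) => S; ring.
    rewrite mulr_sumr [LHS]big_seq [RHS]big_seq; apply: eq_bigr => w.
    by rewrite !inE => /andP[/negbTE -> _].
  rewrite /avg; move: (\sum_(w <- _) _) => S; field.
  by apply/andP; split; apply: lt0r_neq0; lra.
move: tW; rewrite /kernel /memory_coef /twist /step_law.
by case: ifP => _ tW; exact: key.
Qed.

Lemma valid_mem h v : valid h -> v \in h -> v \in Vo \/ v \in Ve.
Proof.
elim: h => // w h IH /= /andP[wW vh]; rewrite inE => /orP[/eqP ->|]; last exact: IH.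
by move: wW; rewrite /parity_steps; case: ifP; [left|right].
Qed.

Lemma step_law_ge0 k v w : 0 <= step_law m Vo Ve p q k v w.
Proof.
have m1 := m_gt1; case/andP: hp => p0 p1; case/andP: hq => q0 q1.
by rewrite /step_law; do 2 case: ifP => // _; rewrite divr_ge0//; lra.
Qed.

Lemma next_law_ge0 h w : 0 <= next_law h w.
Proof.
case: h => [|v h]; first by rewrite invr_ge0.
rewrite /next_law mulr_ge0 ?invr_ge0 ?ler0n//.
by apply: sumr_ge0 => v' _; exact: step_law_ge0.
Qed.

Lemma avg_cst k (a : R) : avg (W k) (fun=> a) = a.
Proof.
rewrite /avg big_const_seq count_predT card_W iter_addr_0 -[a *+ _]mulr_natl mulrA.
by rewrite mulVf ?mul1r// gt_eqF// ltr0n ltnW.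
Qed.

Lemma next_mean_cst h a : valid h -> next_mean h (fun=> a) = a.
Proof.
case: h => [_|v h vh]; first by rewrite -[RHS](avg_cst 1 a) /avg mulr_sumr.
rewrite next_mean_kernel//; rewrite big_seq (eq_bigr (fun=> a)); last first.
  by move=> w /(valid_mem vh) wV; rewrite kernelE// avg_cst; ring.
rewrite -big_seq big_const_seq count_predT iter_addr_0 -[a *+ _]mulr_natl mulrA.
by rewrite mulVf ?mul1r// pnatr_eq0.
Qed.

Lemma le_next_mean h f1 f2 : {in W (size h).+1, forall w, f1 w <= f2 w} ->
  next_mean h f1 <= next_mean h f2.
Proof.
move=> e; rewrite /next_mean [leLHS]big_seq [leRHS]big_seq; apply: ler_sum => w /e le12.
by rewrite ler_wpM2l// next_law_ge0.
Qed.

Lemma hexp_le n g1 g2 :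
  (forall h, valid h -> size h = n -> g1 h <= g2 h) -> hexp n g1 <= hexp n g2.
Proof.
elim: n g1 g2 => [|n IH] g1 g2 e; first exact: e.
rewrite !hexpS; apply: IH => h vh sh; apply: le_next_mean => w wW.
by apply: e; rewrite /= ?wW ?sh.
Qed.

Lemma hexp_cst n a : hexp n (fun=> a) = a.
Proof.
elim: n => // n IH; rewrite hexpS -[RHS]IH; apply: eq_hexp => h vh _.
by rewrite /cexp next_mean_cst.
Qed.

Lemma hexp_ge0 n g : (forall h, valid h -> size h = n -> 0 <= g h) -> 0 <= hexp n g.
Proof. by move=> g0; rewrite -(hexp_cst n 0); exact: hexp_le. Qed.

Lemma trunc_cons n w h : (n <= size h)%N -> trunc n (w :: h) = trunc n h.
Proof. by move=> nh; rewrite /trunc /= subSn. Qed.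

Lemma trunc_id n h : (size h <= n)%N -> trunc n h = h.
Proof. by rewrite -subn_eq0 /trunc => /eqP ->; rewrite drop0. Qed.

Lemma hexp_super n N g : (n <= N)%N ->
  (forall h, valid h -> (n <= size h)%N -> cexp g h <= g h) ->
  hexp N g <= hexp n g.
Proof.
move=> nN sg; rewrite -(subnKC nN); elim: (N - n)%N => [|j IH]; first by rewrite addn0.
apply: le_trans IH; rewrite addnS hexpS; apply: hexp_le => h vh sh.
by apply: sg => //; rewrite sh leq_addr.
Qed.

Lemma hexp_trunc n N g : (n <= N)%N -> hexp N (g \o trunc n) = hexp n g.
Proof.
move=> nN; rewrite -(subnKC nN); elim: (N - n)%N => [|j IH].
  by rewrite addn0; apply: eq_hexp => h _ sh /=; rewrite trunc_id// sh.
rewrite addnS hexpS -IH; apply: eq_hexp => h vh sh.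
rewrite /cexp -[RHS](next_mean_cst _ vh); apply: eq_next_mean => w _ /=.
by rewrite trunc_cons// sh leq_addr.
Qed.

Lemma visited_lt n A h : (size h < n)%N -> visited n A h = false.
Proof.
elim: h => [|w h IH] /=; first by case: n.
by move=> sh; rewrite leqNgt sh/= IH// ltnW.
Qed.

Lemma visited_size n A h : size h = n -> visited n A h -> A h.
Proof.
case: h => [|w h] /= sh; first by rewrite orbF => /andP[].
by rewrite visited_lt ?orbF -?sh// => /andP[].
Qed.

(** Doob's maximal inequality for nonnegative supermartingales: replacing [g / l]
   by 1 once [A] has been met gives again a supermartingale. *)
Lemma hexp_maximal n N (A : pred (seq V)) g (l : R) : (n <= N)%N -> 0 < l ->
  (forall h, valid h -> (n <= size h)%N -> 0 <= g h) ->
  (forall h, valid h -> (n <= size h)%N -> A h -> l <= g h) ->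
  (forall h, valid h -> (n <= size h)%N -> cexp g h <= g h) ->
  hexp N (fun h => (visited n A h)%:R) <= hexp n g / l.
Proof.
move=> nN l0 g0 gA sg.
pose psi h : R := if visited n A h then 1 else g h / l.
have gA1 h : valid h -> (n <= size h)%N -> A h -> 1 <= l^-1 * g h.
  by move=> vh nh /(gA h vh nh); rewrite mulrC ler_pdivlMr// mul1r.
apply: (@le_trans _ _ (hexp N psi)).
  apply: hexp_le => h vh sh; rewrite /psi; case: ifP => // _.
  by rewrite divr_ge0 ?g0// ?sh// ltW.
apply: (@le_trans _ _ (hexp n psi)).
  apply: hexp_super => // h vh nh; rewrite {2}/psi; case: ifP => hV.
    rewrite -[leRHS](next_mean_cst 1 vh); apply: le_next_mean => w _.
    by rewrite /psi /= hV orbT.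
  apply: (@le_trans _ _ (next_mean h (fun w => l^-1 * g (w :: h)))); last first.
    by rewrite next_meanZ mulrC ler_pM2r ?invr_gt0//; exact: sg.
  apply: le_next_mean => w wW; rewrite /psi /= hV orbF (leq_trans nh)//=.
  case: ifP => [/gA1|_]; last by rewrite mulrC.
  by apply; rewrite /= ?wW// (leq_trans nh).
rewrite mulrC -hexpZ; apply: hexp_le => h vh sh; rewrite /psi.
case: ifP => [/(visited_size sh)/gA1|_]; last by rewrite mulrC.
by apply; rewrite ?sh.
Qed.

Lemma hexp_minkowski n g1 g2 :
  Num.sqrt (hexp n (fun h => g1 h ^+ 2)) <=
  Num.sqrt (hexp n (fun h => g2 h ^+ 2)) +
  Num.sqrt (hexp n (fun h => (g1 h - g2 h) ^+ 2)).
Proof.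
apply: sqrt_triangle => [||t t0]; try by apply: hexp_ge0 => h _ _; rewrite sqr_ge0.
rewrite -!hexpZ -hexpD; apply: hexp_le => h _ _; exact: sqr_young.
Qed.

(** Negation exchanges the two step sets, so the favoured element of a uniform
   step is uniform, and so is the next step. *)
Lemma avg_kernel k j f : avg (W k) (fun v => kernel j v f) = avg (W j) f.
Proof.
rewrite /avg (eq_big_seq (fun v => memory_coef j v * f (twist j v) +
   (1 - memory_coef j v) * avg (W j) f)); last first.
  move=> v vW; apply: kernelE; move: vW; rewrite /parity_steps.
  by case: ifP; [left|right].
have [jk|jk] := boolP (odd j == odd k).
  have WE : W k = W j by rewrite /parity_steps (eqP jk).
  rewrite WE (eq_big_seq (fun v => alpha * f v + (1 - alpha) * avg (W j) f)); last first.
    by move=> v vW; rewrite /memory_coef /twist vW.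
  rewrite big_split /= -mulr_sumr mulrDr -/(avg (W j) (fun=> _)) avg_cst.
  by rewrite mulrCA -/(avg (W j) f); ring.
rewrite (eq_big_seq (fun v => beta * f (- v) + (1 - beta) * avg (W j) f)); last first.
  move=> v vW; rewrite /memory_coef /twist.
  suff -> : v \in W j = false by [].
  move: vW jk; rewrite /parity_steps; case: (odd j); case: (odd k) => //= vW _.
    exact: Ve_notin_Vo.
  by apply: contraTF vW => /Ve_notin_Vo ->.
rewrite big_split /= -mulr_sumr mulrDr -/(avg (W k) (fun=> _)) avg_cst.
suff -> : \sum_(v <- W k) f (- v) = \sum_(v <- W j) f v.
  by rewrite mulrCA -/(avg (W j) f); ring.
move: jk; rewrite /parity_steps; case: (odd j); case: (odd k) => //= _.
  by rewrite -(sum_opp (fun v => f (- v))); apply: eq_bigr => v _; rewrite opprK.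
exact: sum_opp.
Qed.

Lemma hexp_sumS n f : hexp n.+1 (fun h => \sum_(v <- h) f v) =
  hexp n (fun h => \sum_(v <- h) f v) + hexp n (fun h => next_mean h f).
Proof.
rewrite hexpS -hexpD; apply: eq_hexp => h vh _; rewrite /cexp.
under [LHS]eq_next_mean do rewrite big_cons.
by rewrite next_meanD next_mean_cst// addrC.
Qed.

(** Every step is uniform on its step set. The two statements support each other:
   the mean of the next step is an average over the steps already made. *)
Lemma hexp_sum_next n f :
  hexp n (fun h => \sum_(v <- h) f v) = \sum_(1 <= k < n.+1) avg (W k) f /\
  hexp n (fun h => next_mean h f) = avg (W n.+1) f.
Proof.
elim: n f => [|n IH] f.
  by split; [rewrite big_geq// /hexp /= big_nil | rewrite /avg mulr_sumr].
have sumE f' : hexp n.+1 (fun h => \sum_(v <- h) f' v) = \sum_(1 <= k < n.+2) avg (W k) f'.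
  by have [IH1 IH2] := IH f'; rewrite hexp_sumS IH1 IH2 [RHS]big_nat_recr.
split; first exact: sumE.
rewrite (eq_hexp (g2 := fun h => n.+1%:R^-1 * \sum_(v <- h) kernel n.+2 v f)).
  rewrite hexpZ sumE (eq_bigr (fun=> avg (W n.+2) f)); last by move=> k _; exact: avg_kernel.
  by rewrite sumr_const_nat subn1 -[avg _ _ *+ _]mulr_natl /= mulrA mulVf ?mul1r// pnatr_eq0.
by move=> [//|v h] _ sh; rewrite next_mean_kernel// sh.
Qed.

(** * The corrected process *)

Let delta := elephant_delta m p q.
Let gamma := (alpha + beta) / 2.

Hypothesis hdelta : 1 / 2 < delta < 1.

(** The bounds 1 and -1 come from p <= 1 and q >= 0; the signs follow because
   alpha - beta = 2 delta exceeds 1. *)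
Lemma coef_bounds : [/\ 0 < alpha, alpha <= 1, -1 <= beta & beta < 0].
Proof.
have m1 : 0 < m%:R - 1 :> R by have := m_gt1; lra.
have mp : (2 : R) <= m%:R by rewrite ler_nat.
have a1 : alpha <= 1.
  by rewrite /alpha /elephant_alpha ler_pdivrMr// mul1r lerD2r ler_piMr// ; case/andP: hp.
have b1 : -1 <= beta.
  rewrite /beta /elephant_beta ler_pdivlMr//.
  have : 0 <= m%:R * q by rewrite mulr_ge0//; case/andP: hq.
  lra.
by move: hdelta; rewrite /delta /elephant_delta -/alpha -/beta => /andP[d1 d2]; split; lra.
Qed.

Lemma gamma_bounds : -1 <= gamma <= 1.
Proof. by have [] := coef_bounds; rewrite /gamma => *; lra. Qed.

(** The sign attached to a step, and the sign of the (n+1)-st step. *)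
Definition sgn v : R := if v \in Vo then 1 else -1.
Definition eps n : R := (-1) ^+ n.

Lemma eps_sqr n : eps n * eps n = 1.
Proof. by rewrite /eps -expr2 sqrr_sign. Qed.

Lemma normr_eps n : `|eps n| = 1.
Proof. by rewrite /eps normrX normrN1 expr1n. Qed.

Lemma epsS n : eps n.+1 = - eps n.
Proof. by rewrite /eps exprS mulN1r. Qed.

Lemma sgn_W n w : w \in W n.+1 -> sgn w = eps n.
Proof.
rewrite /sgn /eps -signr_odd /parity_steps /=; case: (odd n) => /= wW.
  by rewrite Ve_notin_Vo.
by rewrite wW.
Qed.

Lemma normr_sgn v : `|sgn v| = 1.
Proof. by rewrite /sgn; case: ifP; rewrite ?normrN1 ?normr1. Qed.

(** Centred coordinates of the steps are functions of this kind; the convergence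
   is proved for each of them separately. *)
Variable psi : V -> R.
Hypotheses (psiN : {in Ve, forall v, psi (- v) = - psi v}).
Hypotheses (psi0 : \sum_(w <- Vo) psi w = 0).

Definition step_bound : R := \sum_(w <- Vo) `|psi w|.
Definition step_variance : R := avg Vo (fun w => psi w ^+ 2).
Definition plain_sum h : R := \sum_(v <- h) psi v.
Definition alternating_sum h : R := \sum_(v <- h) sgn v * psi v.
Definition drift h : R :=
  (delta * plain_sum h + eps (size h) * gamma * alternating_sum h) / (size h)%:R.

Lemma psi_opp v : v \in Vo \/ v \in Ve -> psi (- v) = - psi v.
Proof.
case=> vV; last exact: psiN.
by have := @psiN (- v); rewrite opp_Ve opprK => /(_ vV) ->; rewrite opprK.
Qed.

Lemma psi_twist k v : v \in Vo \/ v \in Ve ->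
  psi (twist k v) = (if v \in W k then 1 else -1) * psi v.
Proof.
rewrite /twist => hv; case: ifP => vW; first by rewrite mul1r.
by rewrite psi_opp// mulN1r.
Qed.

Lemma step_variance_ge0 : 0 <= step_variance.
Proof.
rewrite /step_variance mulr_ge0 ?invr_ge0//.
by apply: sumr_ge0 => v _; rewrite sqr_ge0.
Qed.

Lemma step_bound_ge0 : 0 <= step_bound.
Proof. by apply: sumr_ge0. Qed.

Lemma psi_bound v : v \in Vo \/ v \in Ve -> `|psi v| <= step_bound.
Proof.
have aux w : w \in Vo -> `|psi w| <= step_bound.
  move=> wV; rewrite /step_bound (big_fsetD1 w)//= lerDl; exact: sumr_ge0.
by case=> [/aux//|vE]; rewrite -normrN -psiN// aux// opp_Vo.
Qed.

Lemma avg_Ve f : avg Ve f = avg Vo (fun v => f (- v)).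
Proof. by rewrite /avg sum_opp. Qed.

Lemma avg_psi k : avg (W k) psi = 0.
Proof.
have aux : avg Vo psi = 0 by rewrite /avg psi0 mulr0.
rewrite /parity_steps; case: ifP => // _; rewrite avg_Ve /avg.
rewrite (eq_big_seq (fun v => -1 * psi v)); last first.
  by move=> v vO; rewrite psi_opp ?mulN1r//; left.
by rewrite -mulr_sumr psi0 !mulr0.
Qed.

Lemma avg_psi_sqr k : avg (W k) (fun v => psi v ^+ 2) = step_variance.
Proof.
rewrite /parity_steps; case: ifP => // _; rewrite avg_Ve /step_variance /avg.
congr (_ * _); apply: eq_big_seq => v vO.
by rewrite psi_opp ?sqrrN//; left.
Qed.

Lemma kernel_psi k v : v \in Vo \/ v \in Ve ->
  kernel k v psi = (if v \in W k then alpha else - beta) * psi v.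
Proof.
move=> hv; rewrite kernelE// avg_psi psi_twist// /memory_coef.
by case: ifP => _; ring.
Qed.

(** A past step contributes alpha psi(v) if it belongs to the current step set and
   - beta psi(v) otherwise, that is (delta + gamma) psi(v) or
   (delta - gamma) psi(v), as the signs of the two steps agree or not. *)
Lemma next_mean_psi h : valid h -> next_mean h psi = drift h.
Proof.
case: h => [_|v0 h].
  by rewrite /drift invr0 mulr0 -[RHS](avg_psi 1) /avg mulr_sumr.
set h1 := v0 :: h => vh; rewrite next_mean_kernel// mulrC; congr (_ / _).
rewrite /plain_sum /alternating_sum !mulr_sumr -big_split.
apply: eq_big_seq => v /(valid_mem vh) hv.
rewrite kernel_psi// /= /gamma /delta /elephant_delta -/alpha -/beta.
suff -> : (if v \in W (size h1).+1 then alpha else - beta) =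
    (alpha - beta) / 2 + eps (size h1) * sgn v * ((alpha + beta) / 2) by ring.
rewrite /parity_steps /eps -signr_odd /sgn /=; case: (odd (size h)) => /=.
  case: hv => hv; first by rewrite hv; field.
  by rewrite (Ve_notin_Vo hv); field.
case: hv => hv; last by rewrite hv (Ve_notin_Vo hv); field.
have -> : v \in Ve = false by apply: contraTF hv => /Ve_notin_Vo ->.
by rewrite hv; field.
Qed.

Lemma plain_sum_bound h : valid h -> `|plain_sum h| <= step_bound * (size h)%:R.
Proof.
elim: h => [_|v h IH vh]; first by rewrite /plain_sum big_nil normr0 mulr0.
rewrite /plain_sum big_cons (le_trans (ler_normD _ _))// -natr1 mulrDr addrC mulr1.
apply: lerD; first by apply: IH; case/andP: vh.
by apply: psi_bound; apply: (valid_mem vh); rewrite mem_head.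
Qed.

Lemma alternating_sum_bound h : valid h -> `|alternating_sum h| <= step_bound * (size h)%:R.
Proof.
elim: h => [_|v h IH vh]; first by rewrite /alternating_sum big_nil normr0 mulr0.
rewrite /alternating_sum big_cons (le_trans (ler_normD _ _))// -natr1 mulrDr addrC mulr1.
apply: lerD; first by apply: IH; case/andP: vh.
by rewrite normrM normr_sgn mul1r psi_bound//; apply: (valid_mem vh); rewrite mem_head.
Qed.

Definition rate n : R := decay delta n.
Definition correction n : R := gamma / 2 * n%:R^-1.

(** The multiple of the alternating sum is chosen so as to cancel the leading term
   of its contribution to the drift; see [alternating_coef_bound]. *)
Definition corrected h : R := rate (size h) *
  (plain_sum h + eps (size h) * correction (size h) * alternating_sum h).

Lemma corrected_cons h w : w \in W (size h).+1 ->
  corrected (w :: h) = rate (size h).+1 *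
    (plain_sum h - eps (size h) * correction (size h).+1 * alternating_sum h +
     (1 - correction (size h).+1) * psi w).
Proof.
move=> wW; rewrite /corrected /= /plain_sum /alternating_sum !big_cons (sgn_W wW) epsS.
(* the sides differ by a multiple of 1 - e ^+ 2 *)
have := eps_sqr (size h); move: (eps _) (rate _) (correction _) => e s c ee.
apply/eqP; rewrite -subr_eq0; apply/eqP.
by transitivity (s * c * psi w * (1 - e * e)); [ring | rewrite ee; ring].
Qed.

Lemma cexp_corrected h : valid h -> cexp corrected h = rate (size h).+1 *
    (plain_sum h - eps (size h) * correction (size h).+1 * alternating_sum h +
     (1 - correction (size h).+1) * drift h).
Proof.
move=> vh; rewrite /cexp (eq_next_mean (fun w => corrected_cons (h := h) (w := w))).
by rewrite next_meanZ next_meanD next_mean_cst// next_meanZ next_mean_psi.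
Qed.

Definition remainder h : R := cexp corrected h - corrected h.

Lemma correction_bound n : (0 < n)%N -> `|correction n| <= n%:R^-1 / 2.
Proof.
move=> n0; have u0 : 0 <= n%:R^-1 :> R by rewrite invr_ge0.
rewrite /correction normrM (ger0_norm u0) mulrC ler_wpM2l// ler_norml.
by have := gamma_bounds => /andP[g0 g1]; apply/andP; split; lra.
Qed.

Lemma delta01 : 0 < delta < 1.
Proof. by move: hdelta => /andP[d1 d2]; apply/andP; split; lra. Qed.

Lemma inv_succ_bounds n : (0 < n)%N ->
  [/\ 0 <= n.+1%:R^-1 :> R, n.+1%:R^-1 <= n%:R^-1 :> R, n%:R^-1 <= 1 :> R &
      n%:R^-1 - n.+1%:R^-1 <= n%:R^-1 * n%:R^-1 :> R].
Proof.
move=> n0; have N0 : 1 <= n%:R :> R by rewrite ler1n.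
split; first by rewrite invr_ge0.
- by rewrite lef_pV2 ?posrE ?ltr0n// ler_nat.
- by rewrite invf_le1 ?ltr0n.
have -> : n%:R^-1 - n.+1%:R^-1 = n%:R^-1 * n.+1%:R^-1 :> R.
  rewrite -natr1; field; apply/andP; split; apply: lt0r_neq0; lra.
by rewrite ler_wpM2l ?invr_ge0// lef_pV2 ?posrE ?ltr0n// ler_nat.
Qed.

(** Each coefficient of the drift is O(n^(-2-delta)) and each sum is O(n). *)
Lemma remainder_bound h : valid h -> (0 < size h)%N ->
  `|remainder h| <= 4 * step_bound * (rate (size h) * (size h)%:R^-1).
Proof.
move=> vh n0; rewrite /remainder cexp_corrected// /corrected /drift.
have := plain_sum_bound vh; have := alternating_sum_bound vh.
have := normr_eps (size h); have := gamma_bounds.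
have := decay_ratio_le delta01 n0; have := decay_ratio_ge delta01 n0.
have := decayS_le delta01 n0; have := decayS_diff delta01 n0.
rewrite -/(rate _) -/(rate (size h).+1) /correction.
have := decay_gt0 delta n0; rewrite -/(rate _).
have := step_bound_ge0; have /andP := delta01.
have := inv_succ_bounds n0.
have nV : (size h)%:R * (size h)%:R^-1 = 1 :> R by rewrite mulfV// gt_eqF// ltr0n.
move: (size h)%:R (rate _) (rate _.+1) nV => N s s' nV.
move: (eps _) (plain_sum h) (alternating_sum h) step_bound N^-1 (_.+1%:R^-1) nV.
move=> e T D B u u' nV [u'0 u'u u1 uu] [d0 d1] B0 s0 sd sle sge sgle /andP[g0 g1] e1 DB TB.
have b1 := plain_coef_bound d0 d1 g0 g1 s0 u'0 u'u sle sge sgle.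
have b2 := alternating_coef_bound d0 g0 g1 s0 u'0 u'u uu sd sle sgle.
rewrite (_ : s' * _ - _ = (s' * (1 + (1 - gamma / 2 * u') * (delta * u)) - s) * T +
  (s' * (gamma * u - gamma / 2 * u' - gamma / 2 * u' * (gamma * u)) -
   s * (gamma / 2 * u)) * (e * D)); last by ring.
apply: (le_trans (ler_normD _ _)); rewrite !normrM e1 mul1r.
have BN : 0 <= B * N by apply: le_trans DB.
have -> : 4 * B * (s * u) = 2 * (s * u * u) * (B * N) + 2 * (s * u * u) * (B * N).
  by transitivity (4 * B * (s * u) * (N * u)); [rewrite nV; ring | ring].
by apply: lerD; apply: ler_pM.
Qed.

Lemma remainder_tail h : valid h -> (0 < size h)%N ->
  `|remainder h| <= 32 * step_bound * (rate (size h) - rate (size h).+1).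
Proof.
move=> vh n0; apply: (le_trans (remainder_bound vh n0)).
have := decayS_tail delta01 n0; rewrite -/(rate _) -/(rate _.+1) => h1.
have h2 : rate (size h) * (size h)%:R^-1 <= 8 * (rate (size h) - rate (size h).+1).
  have : 0 <= rate (size h) * (size h)%:R^-1 by rewrite mulr_ge0 ?invr_ge0// ltW// decay_gt0.
  by move: hdelta => /andP[? ?]; nra.
have := ler_wpM2l (mulr_ge0 (_ : 0 <= 4) step_bound_ge0) h2; lra.
Qed.

(** Compensator of Doob's decomposition, started at time n, so that it is small
   uniformly over the histories when n is large. *)
Fixpoint compensator n h : R :=
  if h is _ :: h' then
    compensator n h' + (if (n <= size h')%N then remainder h' else 0)
  else 0.

Definition mart n h : R := corrected h - compensator n h.

Lemma compensator_eq0 n h : (size h <= n)%N -> compensator n h = 0.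
Proof.
elim: h => //= w h IH sh; rewrite leqNgt sh /= addr0 IH//; exact: ltnW.
Qed.

Lemma compensator_bound n h : valid h -> (0 < n)%N -> (n <= size h)%N ->
  `|compensator n h| <= 32 * step_bound * (rate n - rate (size h)).
Proof.
move=> vh n0; elim: h vh => [_|w h IH]; first by rewrite leqn0 => /eqP n1; rewrite n1 in n0.
move=> vh sh; have [nh|nh] := leqP n (size h); last first.
  rewrite compensator_eq0// normr0 /=.
  have -> : n = (size h).+1 by apply/eqP; rewrite eqn_leq sh nh.
  by rewrite subrr mulr0.
have vh' : valid h by case/andP: vh.
rewrite /= nh (le_trans (ler_normD _ _))//.
have := IH vh' nh; have := remainder_tail vh' (leq_trans n0 nh); lra.
Qed.

Lemma compensator_le n h : valid h -> (0 < n)%N -> (n <= size h)%N ->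
  compensator n h ^+ 2 <= (32 * step_bound * rate n) ^+ 2.
Proof.
move=> vh n0 nh; rewrite -real_normK ?num_real// lerXn2r ?nnegrE//.
  by rewrite !mulr_ge0// ?step_bound_ge0// ltW// decay_gt0.
apply: (le_trans (compensator_bound vh n0 nh)); rewrite ler_wpM2l ?mulr_ge0 ?step_bound_ge0//.
by rewrite gerBl ltW// decay_gt0// (leq_trans n0).
Qed.

(** * The martingale part: convergence in mean square and maximal inequality *)

Definition cond_variance h : R := next_mean h (fun w => psi w ^+ 2) - drift h ^+ 2.

(** The increment of the martingale is psi(w) - drift times the square root of
   this weight, up to sign. *)
Definition increment_weight n : R := (rate n.+1 * (1 - correction n.+1)) ^+ 2.

Lemma mart_cons n h w : valid h -> w \in W (size h).+1 -> (n <= size h)%N ->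
  mart n (w :: h) = mart n h +
    rate (size h).+1 * (1 - correction (size h).+1) * (psi w - drift h).
Proof.
move=> vh wW nh; rewrite /mart /= nh /remainder corrected_cons// cexp_corrected//; ring.
Qed.

Lemma cexp_sqr_mart n h a : valid h -> (n <= size h)%N ->
  next_mean h (fun w => (mart n (w :: h) - a) ^+ 2) =
  (mart n h - a) ^+ 2 + increment_weight (size h) * cond_variance h.
Proof.
move=> vh nh; set s := rate (size h).+1 * (1 - correction (size h).+1).
rewrite (eq_next_mean (f2 := fun w => ((mart n h - a - s * drift h) ^+ 2 +
   (2 * s * (mart n h - a - s * drift h)) * psi w) + s ^+ 2 * psi w ^+ 2)); last first.
  by move=> w wW; rewrite mart_cons// -/s; ring.
rewrite !next_meanD !next_meanZ next_mean_cst// next_mean_psi//.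
by rewrite /increment_weight -/s /cond_variance; ring.
Qed.

Lemma cond_variance_ge0 h : valid h -> 0 <= cond_variance h.
Proof.
move=> vh; rewrite -[leLHS](next_mean_cst 0 vh).
rewrite (_ : cond_variance h = next_mean h (fun w => (psi w - drift h) ^+ 2)).
  by apply: le_next_mean => w _; rewrite sqr_ge0.
rewrite [RHS](eq_next_mean (f2 := fun w =>
    (drift h ^+ 2 + (- 2 * drift h) * psi w) + psi w ^+ 2)).
  by rewrite !next_meanD next_mean_cst// next_meanZ next_mean_psi// /cond_variance; ring.
by move=> w _; ring.
Qed.

Lemma cond_variance_le h : valid h -> cond_variance h <= step_bound ^+ 2.
Proof.
move=> vh; apply: (@le_trans _ _ (next_mean h (fun w => psi w ^+ 2))).
  by rewrite gerBl sqr_ge0.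
rewrite -[leRHS](next_mean_cst _ vh); apply: le_next_mean => w wW.
rewrite -real_normK ?num_real// lerXn2r ?nnegrE ?step_bound_ge0// psi_bound//.
by apply: (@valid_mem (w :: h)); rewrite ?mem_head//= wW.
Qed.

Let theta := 2 * delta - 1.

Lemma theta01 : 0 < theta < 1.
Proof. by move: hdelta => /andP[d1 d2]; rewrite /theta; apply/andP; split; lra. Qed.

Lemma rate_sqr n : (0 < n)%N -> rate n ^+ 2 = decay theta n * n%:R^-1.
Proof.
move=> n0; rewrite expr2 /rate -!decayD// -decay1// -decayD//; congr decay.
by rewrite /theta; ring.
Qed.

Lemma correction_half n : `|correction n.+1| <= 1 / 2.
Proof.
apply: (le_trans (correction_bound (isT : (0 < n.+1)%N))).
by rewrite ler_pM2r// invf_le1 ?ltr0n// ler1n.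
Qed.

Lemma increment_weight_le n : (0 < n)%N -> increment_weight n <= 4 * rate n ^+ 2.
Proof.
move=> n0; rewrite /increment_weight exprMn mulrC; apply: ler_pM; rewrite ?sqr_ge0//.
  by have := correction_half n; rewrite ler_norml => /andP[? ?]; nra.
have := decayS_le delta01 n0; have := @decay_gt0 R delta n.+1 isT => s0 ss.
by rewrite !expr2; apply: ler_pM => //; rewrite ltW.
Qed.

Lemma increment_weight_ge n : rate n.+1 ^+ 2 / 4 <= increment_weight n.
Proof.
rewrite /increment_weight exprMn; apply: ler_pM; rewrite ?sqr_ge0//.
by have := correction_half n; rewrite ler_norml => /andP[? ?]; nra.
Qed.

(** A telescoping bound for the energy that the martingale can still gain after
   time n. *)
Definition tail_energy n : R := 16 * step_bound ^+ 2 / theta * decay theta n.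

Lemma tail_energy_step h : valid h -> (0 < size h)%N ->
  increment_weight (size h) * cond_variance h <=
  tail_energy (size h) - tail_energy (size h).+1.
Proof.
move=> vh n0; apply: (@le_trans _ _ (4 * rate (size h) ^+ 2 * step_bound ^+ 2)).
  apply: ler_pM; rewrite ?cond_variance_ge0 ?cond_variance_le ?increment_weight_le ?sqr_ge0//.
rewrite rate_sqr//; have := decayS_tail theta01 n0.
have /andP[t0 _] := theta01 => h1; rewrite /tail_energy -mulrBr.
have c0 : 0 <= 8 * step_bound ^+ 2 / theta.
  by apply: divr_ge0; [rewrite mulr_ge0 ?sqr_ge0 | rewrite ltW].
have tn0 : theta != 0 by rewrite gt_eqF.
rewrite [leLHS](_ : _ = 8 * step_bound ^+ 2 / theta *
  (theta / 2 * (decay theta (size h) * (size h)%:R^-1))); last first.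
  by field; rewrite tn0 andbT pnatr_eq0 -lt0n.
apply: (le_trans (ler_wpM2l c0 h1)).
by rewrite le_eqVlt; apply/orP; left; apply/eqP; field.
Qed.

Lemma tail_energy_ge0 n : 0 <= tail_energy n.
Proof.
have /andP[t0 _] := theta01.
rewrite /tail_energy mulr_ge0 ?powR_ge0//; apply: divr_ge0; last by rewrite ltW.
by rewrite mulr_ge0 ?sqr_ge0.
Qed.

Definition modulus n : R := 2 * (32 * step_bound * rate n) ^+ 2 + 2 * tail_energy n.

(** A supermartingale that dominates the squared variation of the corrected
   process since time n, and whose value at time n is the deterministic
   [modulus n]. *)
Definition envelope n h : R :=
  2 * (mart n h - corrected (trunc n h)) ^+ 2 + 2 * (32 * step_bound * rate n) ^+ 2
  + 2 * tail_energy (size h).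

Lemma envelope_trunc n h : size h = n -> envelope n h = modulus n.
Proof.
move=> sh; rewrite /envelope /mart trunc_id ?compensator_eq0 ?sh// subr0 subrr.
by rewrite expr0n mulr0 add0r.
Qed.

Lemma envelope_ge0 n h : 0 <= envelope n h.
Proof.
by apply: addr_ge0; [apply: addr_ge0|]; apply: mulr_ge0; rewrite // ?sqr_ge0 ?tail_energy_ge0.
Qed.

Lemma envelope_super n h : (0 < n)%N -> valid h -> (n <= size h)%N ->
  cexp (envelope n) h <= envelope n h.
Proof.
move=> n0 vh nh; rewrite /cexp (eq_next_mean (f2 := fun w =>
  2 * (mart n (w :: h) - corrected (trunc n h)) ^+ 2 +
  (2 * (32 * step_bound * rate n) ^+ 2 + 2 * tail_energy (size h).+1))); last first.
  by move=> w _; rewrite /envelope trunc_cons// addrA.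
rewrite next_meanD next_mean_cst// next_meanZ cexp_sqr_mart// /envelope.
by have := tail_energy_step vh (leq_trans n0 nh); lra.
Qed.

Lemma envelope_dom n h : (0 < n)%N -> valid h -> (n <= size h)%N ->
  (corrected h - corrected (trunc n h)) ^+ 2 <= envelope n h.
Proof.
move=> n0 vh nh; have := compensator_le vh n0 nh; have := tail_energy_ge0 (size h).
rewrite /envelope /mart; move: (corrected h) (corrected (trunc n h)) (compensator _ _) => x y c.
by have := sqr_ge0 (x - c - y - c); lra.
Qed.

Lemma corrected_increment n N : (0 < n <= N)%N ->
  hexp N (fun h => (corrected h - corrected (trunc n h)) ^+ 2) <= modulus n.
Proof.
move=> /andP[n0 nN]; apply: (@le_trans _ _ (hexp N (envelope n))).
  by apply: hexp_le => h vh sh; apply: envelope_dom; rewrite ?sh.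
apply: (@le_trans _ _ (hexp n (envelope n))).
  by apply: hexp_super => // h vh nh; exact: envelope_super.
by rewrite -[leRHS](hexp_cst n); apply: hexp_le => h vh sh; rewrite envelope_trunc.
Qed.

Lemma corrected_maximal n N (l : R) : (0 < n <= N)%N -> 0 < l ->
  hexp N (fun h => (visited n
      (fun h' => l <= (corrected h' - corrected (trunc n h')) ^+ 2) h)%:R)
    <= modulus n / l.
Proof.
move=> /andP[n0 nN] l0; apply: (@le_trans _ _ (hexp n (envelope n) / l)).
  apply: hexp_maximal => //.
  - by move=> h _ _; exact: envelope_ge0.
  - by move=> h vh nh /le_trans; apply; exact: envelope_dom.
  - by move=> h vh nh; exact: envelope_super.
rewrite ler_pM2r ?invr_gt0// -[leRHS](hexp_cst n); apply: hexp_le => h vh sh.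
by rewrite envelope_trunc.
Qed.

Lemma modulus_cvg0 : modulus n @[n --> \oo] --> 0.
Proof.
have -> : modulus = (fun n => 2 * ((32 * step_bound) ^+ 2 * (rate n * rate n)) +
  2 * (16 * step_bound ^+ 2 / theta * decay theta n)).
  by apply/funext => n; rewrite /modulus /tail_energy; ring.
have /andP[t0 _] := theta01; have /andP[d0 _] := delta01.
have h1 := decay_cvg0 d0; have h2 := decay_cvg0 t0.
rewrite (_ : 0 = 2 * ((32 * step_bound) ^+ 2 * (0 * 0)) +
  2 * (16 * step_bound ^+ 2 / theta * 0)); last by ring.
by apply: cvgD; apply: cvgMr; apply: cvgMr => //; exact: cvgM.
Qed.

Lemma hexp_plain_alternating n : hexp n plain_sum = 0 /\ hexp n alternating_sum = 0.
Proof.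
split; rewrite (hexp_sum_next n _).1 big_nat big1// => k /andP[k0 _].
  exact: avg_psi.
case: k k0 => // k _; rewrite /avg (eq_big_seq (fun v => eps k * psi v)).
  by rewrite -mulr_sumr mulrCA -/(avg (W k.+1) psi) avg_psi mulr0.
by move=> v vW; rewrite (sgn_W vW).
Qed.

Lemma hexp_corrected n : hexp n corrected = 0.
Proof.
have [h1 h2] := hexp_plain_alternating n.
rewrite (eq_hexp (g2 := fun h => rate n * plain_sum h +
   rate n * (eps n * correction n) * alternating_sum h)).
  by rewrite hexpD !hexpZ h1 h2 !mulr0 addr0.
by move=> h _ sh; rewrite /corrected sh; ring.
Qed.

Lemma plain_sum_near_corrected h : valid h -> (0 < size h)%N ->
  `|rate (size h) * plain_sum h - corrected h| <= step_bound * rate (size h).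
Proof.
move=> vh n0; have := correction_bound n0; rewrite /corrected; move: (correction _) => c cb.
rewrite mulrDr opprD addNKr normrN !normrM normr_eps mul1r mulrC.
have s0 : 0 < rate (size h) := decay_gt0 _ n0.
rewrite (gtr0_norm s0) ler_wpM2r ?(ltW s0)//.
have := ler_pM (normr_ge0 _) (normr_ge0 _) cb (alternating_sum_bound vh).
move/le_trans; apply; have := step_bound_ge0 => b0.
have : (size h)%:R^-1 * (size h)%:R = 1 :> R by rewrite mulVf// gt_eqF// ltr0n.
move: (size h)%:R => N nN.
rewrite (_ : N^-1 / 2 * (step_bound * N) = N^-1 * N * (step_bound / 2)); last by ring.
by rewrite nN; lra.
Qed.

Lemma hexp_sqrt_lipschitz n g1 g2 (e : R) :
  hexp n (fun h => (g1 h - g2 h) ^+ 2) <= e ->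
  `|Num.sqrt (hexp n (fun h => g1 h ^+ 2)) - Num.sqrt (hexp n (fun h => g2 h ^+ 2))|
    <= Num.sqrt e.
Proof.
move=> le_e; have se := ler_wsqrtr le_e.
have h1 := hexp_minkowski n g1 g2; have := hexp_minkowski n g2 g1.
rewrite (eq_hexp (g1 := fun h => (g2 h - g1 h) ^+ 2)
  (g2 := fun h => (g1 h - g2 h) ^+ 2)); last first.
  by move=> h _ _; rewrite -sqrrN opprB.
by move=> h2; rewrite ler_distlC; apply/andP; split; lra.
Qed.

Definition root_mean_square n : R := Num.sqrt (hexp n (fun h => corrected h ^+ 2)).

Lemma root_mean_square_dist n N : (0 < n <= N)%N -> `|root_mean_square N - root_mean_square n| <= Num.sqrt (modulus n).
Proof.
move=> nN; rewrite /root_mean_square -(@hexp_trunc n N); last by case/andP: nN.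
exact: (hexp_sqrt_lipschitz (corrected_increment nN)).
Qed.

Lemma root_mean_square_cvg : cvgn root_mean_square.
Proof.
apply/cauchy_cvgP/cauchy_exP => e e0.
have := sqrt_cvg0 modulus_cvg0 => /cvgrPdist_lt /(_ _ e0) [n0 _ hn].
exists (root_mean_square n0.+1); exists n0.+1 => // N /= nN.
rewrite /ball /= distrC; apply: le_lt_trans (root_mean_square_dist _) _; first by rewrite nN.
by have := hn n0.+1 (leqnSn _); rewrite sub0r normrN ger0_norm ?sqrtr_ge0.
Qed.

Definition limit_variance : R := limn root_mean_square ^+ 2.

Lemma limit_variance_ge0 : 0 <= limit_variance. Proof. exact: sqr_ge0. Qed.

Lemma root_mean_square_sqr n : hexp n (fun h => corrected h ^+ 2) = root_mean_square n ^+ 2.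
Proof. by rewrite /root_mean_square sqr_sqrtr// hexp_ge0// => h _ _; rewrite sqr_ge0. Qed.

Lemma hexp_corrected_sqr_cvg :
  hexp n (fun h => corrected h ^+ 2) @[n --> \oo] --> limit_variance.
Proof.
rewrite (_ : (fun n => _) = (fun n => root_mean_square n ^+ 2)); last first.
  by apply/funext => n; rewrite root_mean_square_sqr.
by under eq_fun do rewrite expr2; apply: cvgM; exact: root_mean_square_cvg.
Qed.

Lemma plain_sum_variance_cvg :
  hexp n (fun h => (rate n * plain_sum h) ^+ 2) @[n --> \oo] --> limit_variance.
Proof.
pose r n : R := Num.sqrt (hexp n (fun h => (rate n * plain_sum h) ^+ 2)).
rewrite (_ : (fun n => _) = (fun n => r n ^+ 2)); last first.
  by apply/funext => n; rewrite /r sqr_sqrtr// hexp_ge0// => h _ _; rewrite sqr_ge0.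
suff rc : r n @[n --> \oo] --> limn root_mean_square.
  by under eq_fun do rewrite expr2; apply: cvgM.
have d0 : (r n - root_mean_square n) @[n --> \oo] --> 0.
  apply/cvgr0Pnorm_le => e e0.
  have /andP[dl0 _] := delta01.
  have h1 : step_bound * rate n @[n --> \oo] --> 0.
    by rewrite -(mulr0 step_bound); apply: cvgMr; exact: decay_cvg0.
  near=> n.
  have n0 : (0 < n)%N by near: n; exists 1%N.
  have b0 : 0 <= step_bound * rate n by rewrite mulr_ge0 ?step_bound_ge0// ltW// decay_gt0.
  apply: (@le_trans _ _ (step_bound * rate n)); last first.
    rewrite -[leLHS]ger0_norm//; near: n; move/cvgr0Pnorm_le: h1; exact.
  rewrite -[leRHS]ger0_norm// -[leRHS]sqrtr_sqr; apply: hexp_sqrt_lipschitz.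
  rewrite -[leRHS](hexp_cst n); apply: hexp_le => h vh sh.
  rewrite -real_normK ?num_real// lerXn2r ?nnegrE// -sh plain_sum_near_corrected// sh//.
rewrite (_ : r = (fun n => (r n - root_mean_square n) + root_mean_square n)); last by apply/funext => n; rewrite subrK.
by rewrite -[X in _ --> X]add0r; apply: cvgD => //; exact: root_mean_square_cvg.
Unshelve. all: by end_near. Qed.

(** * Positivity of the limit variance *)

Lemma sqr_sum_le h (F : V -> R) :
  (\sum_(v <- h) F v) ^+ 2 <= (size h)%:R * \sum_(v <- h) F v ^+ 2.
Proof.
elim: h => [|v h IH]; first by rewrite !big_nil expr0n mulr0.
rewrite !big_cons /= -natr1; move: IH (ler0n R (size h)).
case: (size h) (size_eq0 h) => [|N] hN.
  have /eqP -> : h == [::] by rewrite -hN.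
  by rewrite !big_nil !addr0 mulr0n add0r mul1r.
move: (\sum_(_ <- _) F _) (\sum_(_ <- _) F _ ^+ 2) => S Q; set M : R := N.+1%:R => SQ M0.
have M1 : 0 < M by rewrite ltr0n.
have : 2 * F v * S <= M * F v ^+ 2 + Q.
  rewrite -(ler_pM2l M1); have := sqr_ge0 (M * F v - S); lra.
lra.
Qed.

(** The numbers of odd and of even integers up to n differ by at most one. *)
Lemma sum_parity_le n b (x y : R) : 0 <= x <= 1 -> 0 <= y <= 1 ->
  \sum_(1 <= k < n.+1) (if odd k == b then x else y) <= n%:R * ((x + y) / 2) + 1 / 2.
Proof.
move=> /andP[x0 x1] /andP[y0 y1].
suff -> : \sum_(1 <= k < n.+1) (if odd k == b then x else y) =
    n%:R * ((x + y) / 2) + (if odd n then (if b then x - y else y - x) / 2 else 0).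
  by rewrite lerD2l; case: ifP => _; [case: b|]; lra.
elim: n => [|n IH]; first by rewrite big_geq// mul0r addr0.
rewrite big_nat_recr//= IH -[n.+1%:R]natr1; case: (odd n); case: b {IH} => /=.
all: by field.
Qed.

(** By convexity the squared drift is at most the average over the past of the
   squared contributions alpha^2 psi^2 or beta^2 psi^2. About half of the steps
   contribute each, and alpha^2 + beta^2 <= alpha - beta = 2 delta. *)
Lemma drift_sqr_le n : (0 < n)%N ->
  hexp n (fun h => drift h ^+ 2) <= step_variance * (delta + (2 * n%:R)^-1).
Proof.
move=> n0; have [a0 a1 b0 b1] := coef_bounds.
have nn : (n%:R : R) != 0 by rewrite pnatr_eq0 -lt0n.
pose F v : R := ((if v \in W n.+1 then alpha else - beta) * psi v) ^+ 2.
apply: (@le_trans _ _ (hexp n (fun h => n%:R^-1 * \sum_(v <- h) F v))).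
  apply: hexp_le => h vh sh; rewrite -next_mean_psi// next_mean_kernel; last first.
    by rewrite -size_eq0 sh -lt0n.
  rewrite exprMn sh expr2 -mulrA ler_wpM2l ?invr_ge0//.
  rewrite -(ler_pM2l (_ : 0 < n%:R)) ?ltr0n// mulrA mulfV// mul1r.
  rewrite (eq_big_seq (fun v => (if v \in W n.+1 then alpha else - beta) * psi v)); last first.
    by move=> v /(valid_mem vh) hv; rewrite kernel_psi.
  have := sqr_sum_le h (fun v => (if v \in W n.+1 then alpha else - beta) * psi v).
  by rewrite sh.
rewrite hexpZ (hexp_sum_next n F).1.
have -> : \sum_(1 <= k < n.+1) avg (W k) F = step_variance *
    \sum_(1 <= k < n.+1) (if odd k == odd n.+1 then alpha ^+ 2 else beta ^+ 2).
  rewrite mulr_sumr; apply: eq_bigr => k _; rewrite -(avg_psi_sqr k) /avg -mulrA mulr_suml.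
  congr (_ * _); apply: eq_big_seq => v vW; rewrite /F exprMn mulrC; congr (_ * _).
  move: vW; rewrite /parity_steps; case: (odd k); case: (odd n.+1) => vW //=.
  - by rewrite vW.
  - by rewrite (_ : v \in Ve = false) ?sqrrN//; apply: contraTF vW => /Ve_notin_Vo ->.
  - by rewrite Ve_notin_Vo ?sqrrN.
  - by rewrite vW.
rewrite mulrCA ler_wpM2l ?step_variance_ge0// mulrC ler_pdivrMr ?ltr0n//.
have a2 : 0 <= alpha ^+ 2 <= 1 by rewrite sqr_ge0 expr_le1 // ltW.
have b2 : 0 <= beta ^+ 2 <= 1 by rewrite sqr_ge0 -sqrrN expr_le1//; lra.
apply: (le_trans (sum_parity_le _ _ a2 b2)).
have -> : (delta + (2 * n%:R)^-1) * n%:R = n%:R * delta + 1 / 2 by field.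
rewrite lerD2r ler_wpM2l// /delta /elephant_delta -/alpha -/beta.
have : alpha ^+ 2 <= alpha by rewrite expr2 ler_piMl// ltW.
have : beta ^+ 2 <= - beta by rewrite -sqrrN expr2 ler_piMl//; lra.
lra.
Qed.

Lemma hexp_cond_variance_ge n : (0 < n)%N -> n%:R^-1 <= 1 - delta ->
  step_variance * ((1 - delta) / 2) <= hexp n cond_variance.
Proof.
move=> n0 hn.
rewrite (eq_hexp (g2 := fun h =>
  next_mean h (fun w => psi w ^+ 2) + -1 * drift h ^+ 2)); last first.
  by move=> h _ _; rewrite mulN1r.
rewrite hexpD hexpZ (hexp_sum_next n (fun w => psi w ^+ 2)).2 avg_psi_sqr mulN1r.
have := drift_sqr_le n0; rewrite invfM.
have : 0 <= step_variance * (1 - delta - n%:R^-1).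
  by rewrite mulr_ge0 ?subr_ge0 ?step_variance_ge0.
lra.
Qed.

(** The energy gained at time k is at least of order k^(-2delta), so the total is
   compared with a telescoping sum of n^(1-2delta). *)
Lemma mart_energy_ge n N : (0 < n <= N)%N -> n%:R^-1 <= 1 - delta ->
  step_variance * (1 - delta) / 8 * (decay theta n.+1 - decay theta N.+1) <=
  hexp N (fun h => mart n h ^+ 2).
Proof.
move=> /andP[n0 nN] hn; rewrite -(subnKC nN); elim: (N - n)%N => [|j IH].
  by rewrite addn0 subrr mulr0 hexp_ge0// => h _ _; rewrite sqr_ge0.
rewrite addnS; set k := (n + j)%N in IH *.
have k0 : (0 < k)%N by rewrite addn_gt0 n0.
rewrite hexpS (eq_hexp (g2 := fun h =>
  mart n h ^+ 2 + increment_weight k * cond_variance h)); last first.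
  move=> h vh sh; rewrite -sh -[in RHS](subr0 (mart n h)) -cexp_sqr_mart ?sh ?leq_addr//.
  by apply: eq_next_mean => w _; rewrite subr0.
rewrite hexpD hexpZ; apply: le_trans (lerD IH _); last first.
  apply: (@ler_pM _ (rate k.+1 ^+ 2 / 4) _ (step_variance * ((1 - delta) / 2))).
  - by rewrite divr_ge0 ?sqr_ge0.
  - have /andP[_ d1] := delta01.
    by rewrite mulr_ge0 ?divr_ge0 ?subr_ge0 ?(ltW d1) ?step_variance_ge0.
  - exact: increment_weight_ge.
  - apply: hexp_cond_variance_ge => //; apply: le_trans hn.
    by rewrite lef_pV2 ?posrE ?ltr0n// ler_nat leq_addr.
rewrite rate_sqr//; have := decayS_diff theta01 (isT : (0 < k.+1)%N).
have : 0 <= step_variance * (1 - delta).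
  by have /andP[_ d1] := delta01; rewrite mulr_ge0 ?subr_ge0 ?(ltW d1) ?step_variance_ge0.
move: (k.+1%:R^-1) (decay theta k.+1) (decay theta k.+2) (decay theta n.+1) => u x y z.
by move=> c0 /(ler_wpM2l c0); lra.
Qed.

Lemma limit_variance_ge n : (0 < n)%N -> n%:R^-1 <= 1 - delta ->
  step_variance * (1 - delta) / 16 * decay theta n.+1 - (32 * step_bound * rate n) ^+ 2
    <= limit_variance.
Proof.
move=> n0 hn; have /andP[t0 _] := theta01.
set c := step_variance * (1 - delta) / 8.
have -> : step_variance * (1 - delta) / 16 = c / 2 by rewrite /c; field.
set K := (32 * step_bound * rate n) ^+ 2.
have lhs : (c / 2 * (decay theta n.+1 - decay theta N.+1) - K) @[N --> \oo] -->
    c / 2 * decay theta n.+1 - K.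
  apply: cvgB; last exact: cvg_cst.
  apply: cvgMr; rewrite -[X in _ --> X]subr0; apply: cvgB; first exact: cvg_cst.
  by have := decay_cvg0 t0; rewrite -cvg_shiftS.
apply: (ler_cvg_to lhs hexp_corrected_sqr_cvg); exists n => // N /= nN.
have nN' : (0 < n <= N)%N by rewrite n0.
have := mart_energy_ge nN' hn; rewrite -/c.
have : hexp N (fun h => mart n h ^+ 2) <= 2 * hexp N (fun h => corrected h ^+ 2) + 2 * K.
  rewrite -hexpZ -[2 * K](hexp_cst N) -hexpD; apply: hexp_le => h vh sh.
  have := compensator_le vh n0; rewrite sh => /(_ nN); rewrite -/K /mart.
  by move: (corrected h) (compensator _ _) => x y; have := sqr_ge0 (x + y); lra.
lra.
Qed.

(** In [limit_variance_ge] the energy is of order n^(1-2delta) and the squared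
   compensator of order n^(-2delta): the former wins for large n. *)
Lemma limit_variance_gt0 : 0 < step_variance -> 0 < limit_variance.
Proof.
move=> v0; have /andP[t0 t1] := theta01; have /andP[_ d1] := delta01.
set c := step_variance * (1 - delta) / 16; set K := (32 * step_bound) ^+ 2.
have c0 : 0 < c by rewrite divr_gt0// mulr_gt0// subr_gt0.
near \oo => n.
have n0 : (0 < n)%N by near: n; exists 1%N.
have nR : 0 < n%:R :> R by rewrite ltr0n.
have hn : n%:R^-1 <= 1 - delta.
  rewrite invf_ple ?posrE ?subr_gt0//; near: n; exact: nbhs_infty_ger.
have cK : 2 * K * n%:R^-1 < c.
  rewrite ltr_pdivrMr// [c * _]mulrC -ltr_pdivrMr//; near: n; exact: nbhs_infty_gtr.
apply: lt_le_trans (limit_variance_ge n0 hn).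
rewrite -/c exprMn -/K rate_sqr//.
have := decay_ratio_le theta01 n0.
have := @decay_gt0 R theta n.+1 isT; move: (decay theta n) (decay _ _) => x y y0 xy.
have u0 : 0 <= n%:R^-1 :> R by rewrite invr_ge0.
have u1 : n%:R^-1 <= 1 :> R by rewrite invf_le1// ler1n.
have {xy} x2 : x <= 2 * y.
  apply: (le_trans xy); rewrite mulrC ler_wpM2r ?(ltW y0)//.
  by have := mulr_ile1 (ltW t0) u0 (ltW t1) u1; lra.
have : K * (x * n%:R^-1) <= K * ((2 * y) * n%:R^-1).
  by rewrite ler_wpM2l ?sqr_ge0// ler_wpM2r.
have : 2 * K * n%:R^-1 * y < c * y by rewrite ltr_pM2r.
lra.
Unshelve. all: by end_near. Qed.

End history.

(** * Events determined by finitely many independent sources *)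

Section past_events.
Context {R : realType} {disp : measure_display} {Omega : measurableType disp}.
Variables (P : probability Omega R) (F : nat -> set (set Omega)).
Hypotheses (F_measurable : forall n B, F n B -> measurable B).
Hypothesis F_indep : mutually_independent P F.

(** E depends only on the sources of index less than n, in the form in which this
   is used: E is independent of every finite family of later sources. Unlike the
   product form of mutual independence, this property is stable under finite
   disjoint unions. *)
Definition past n (E : set Omega) : Prop := measurable E /\
  forall (J : {fset nat}) (A : nat -> set Omega),
    (forall i, i \in J -> (n <= i)%N /\ F i (A i)) ->
    P (E `&` \bigcap_(i in [set` J]) A i) = (P E * \prod_(i <- J) P (A i))%E.

Lemma past0 : past 0 [set: Omega].
Proof.
split=> // J A hA; rewrite setTI probability_setT mul1e; apply: F_indep => i iJ.
by have [] := hA i iJ.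
Qed.

Lemma pastI n E B : past n E -> F n B -> P (E `&` B) = (P E * P B)%E.
Proof.
move=> [_ hE] FB; have := hE [fset n]%fset (fun=> B).
rewrite big_seq_fset1 set_fset1 bigcap_set1; apply=> i.
by rewrite inE => /eqP ->.
Qed.

Lemma pastS n E B : past n E -> F n B -> past n.+1 (E `&` B).
Proof.
move=> pE FB; split; first by apply: measurableI; [case: pE | exact: F_measurable FB].
move=> J A hA; pose A' i := if i == n then B else A i.
have nJ : n \notin J by apply/negP => /hA []; rewrite ltnn.
have A'E i : i \in J -> A' i = A i.
  by move=> iJ; rewrite /A'; case: eqP => // iE; rewrite iE (negbTE nJ) in iJ.
have [_ hE] := pE; have := hE (n |` J)%fset A'.
have A'n : A' n = B by rewrite /A' eqxx.
rewrite bigcap_fsetU1 big_fsetU1//= A'n.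
have -> : \bigcap_(i in [set` J]) A' i = \bigcap_(i in [set` J]) A i.
  by apply: eq_bigcapr => i /=; exact: A'E.
rewrite (eq_big_seq (fun i => P (A i))) => [|i iJ]; last by rewrite A'E.
rewrite setIA (pastI pE FB) muleA; apply => i; rewrite inE => /orP[].
  by rewrite inE => /eqP ->; rewrite /A' eqxx.
by move=> iJ; have [ni Fi] := hA i iJ; rewrite (A'E i)// ltnW.
Qed.

Lemma past_bigsetU n N (E : nat -> set Omega) : (forall k, past n (E k)) ->
  trivIset setT E -> past n (\big[setU/set0]_(k < N) E k).
Proof.
move=> pE tE; split; first by apply: bigsetU_measurable => k _; case: (pE k).
move=> J A hA; set C := \bigcap_(i in _) _.
have mC : measurable C.
  by apply: fin_bigcap_measurable => // i iJ; apply: (@F_measurable i); case: (hA i iJ).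
have mE k : measurable (E k) by case: (pE k).
rewrite big_distrl/=.
rewrite (measure_bigsetU _ (fun k => measurableI _ _ (mE k) mC)); last exact: trivIset_setIr.
rewrite (measure_bigsetU _ mE)// ge0_sume_distrl; last by move=> i _; exact: measure_ge0.
by apply: eq_bigr => k _; case: (pE k) => _; apply.
Qed.

End past_events.

(** * The law of the history of the walk *)

Lemma vborel_set1 (R : realType) d (w : 'rV[R]_d) : vborel [set w].
Proof.
rewrite -[[set w]]setCK; apply: sigma_algebraC; apply: sub_sigma_algebra.
apply: closed_openC; apply: accessible_closed_set1.
by apply: hausdorff_accessible; exact: norm_hausdorff.
Qed.

Section law_of_the_past.
Context {R : realType} {d : nat}.
Variables (Vo Ve : {fset 'rV[R]_d}) (m : nat) (p q : R).
Local Notation V := 'rV[R]_d.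
Local Notation W := (parity_steps Vo Ve).
Implicit Types (h : seq V) (g : seq V -> R) (k n : nat) (v w : V).
Context {disp : measure_display} {Omega : measurableType disp}.
Variables (P : probability Omega R) (X : nat -> Omega -> V)
  (U : nat -> Omega -> nat) (G : nat -> V -> Omega -> V).
Hypothesis walk : elephant_walk P m Vo Ve p q X U G.

Lemma sub_smallest_sigma (F : set (set Omega)) : F `<=` measurable ->
  <<s F >> `<=` measurable.
Proof. by apply: smallest_sub; exact: sigma_algebra_measurable. Qed.

Lemma memory_measurable n B : (1 <= n)%N -> sigma_memory U n B -> measurable B.
Proof.
move=> n1 [A _ <-]; rewrite setTI; have := erw_U_rv walk n1.
by move=> /(_ measurableT A I); rewrite setTI.
Qed.

Lemma steps_measurable n B : (2 <= n)%N -> sigma_steps Vo Ve G n B -> measurable B.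
Proof.
move=> n2; apply: sub_smallest_sigma => _ [v /= vV] [A hA <-]; rewrite setTI.
exact: (erw_G_rv walk).
Qed.

Lemma innovation_measurable n B : innovation Vo Ve X U G n B -> measurable B.
Proof.
case: n => [[A hA <-]|n]; first by rewrite setTI; exact: (erw_X1_rv walk).
apply: sub_smallest_sigma => A [|]; first exact: memory_measurable.
exact: steps_measurable.
Qed.

Local Notation past := (past P (innovation Vo Ve X U G)).

Fixpoint hist n x : seq V := if n is n'.+1 then X n'.+1 x :: hist n' x else [::].

Lemma size_hist n x : size (hist n x) = n.
Proof. by elim: n => //= n ->. Qed.

(** The head of the history is X n, so X k+1 sits at position n - (k+1). *)
Lemma nth_hist n k x : (k < n)%N -> nth 0 (hist n x) (n - k.+1) = X k.+1 x.
Proof.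
elim: n => // n IH; rewrite ltnS leq_eqVlt => /orP[/eqP ->|kn].
  by rewrite subSS subnn.
rewrite subSS -(@prednK (n - k)%N) ?subn_gt0//= -subnS.
exact: IH.
Qed.

Lemma walk_in_steps n x : X n.+1 x \in W n.+1.
Proof.
elim/ltn_ind: n => -[_|n IH]; first exact: (erw_X1_val walk).
rewrite (erw_step walk)//; apply: (erw_G_val walk) => //.
have /andP[] := erw_U_val walk x (isT : (1 <= n.+1)%N).
case: (U n.+1 x) => // k _ kn; have := IH k kn; rewrite /parity_steps inE.
by case: ifP => _ ->; rewrite ?orbT.
Qed.

Lemma valid_hist n x : valid Vo Ve (hist n x).
Proof. by elim: n => //= n ->; rewrite size_hist walk_in_steps. Qed.

Definition step_event n v w k : set Omega :=
  [set x | U n x = k.+1] `&` [set x | G n.+1 v x = w].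

Lemma step_event_innovation n v w k : (1 <= n)%N -> v \in (Vo `|` Ve)%fset ->
  innovation Vo Ve X U G n (step_event n v w k) /\
  P (step_event n v w k) = (P [set x | U n x = k.+1] * P [set x | G n.+1 v x = w])%E.
Proof.
case: n => // n _ vV.
have mU : sigma_memory U n.+1 [set x | U n.+1 x = k.+1].
  by exists [set k.+1] => //; rewrite setTI.
have mG : sigma_steps Vo Ve G n.+2 [set x | G n.+2 v x = w].
  apply: sub_sigma_algebra; exists v => //; exists [set w]; first exact: vborel_set1.
  by rewrite setTI.
split; last exact: (erw_indep_UG walk (isT : (1 <= n.+1)%N) mU mG).
have sI (A B : set Omega) : <<s sigma_memory U n.+1 `|` sigma_steps Vo Ve G n.+2 >> A ->
    <<s sigma_memory U n.+1 `|` sigma_steps Vo Ve G n.+2 >> B ->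
    <<s sigma_memory U n.+1 `|` sigma_steps Vo Ve G n.+2 >> (A `&` B).
  exact: (@measurableI _ (g_sigma_algebraType _)).
by apply: sI; apply: sub_sigma_algebra; [left|right].
Qed.

Definition hist_event (h : seq V) : set Omega := [set x | hist (size h) x = h].

Definition branch_event h w k : set Omega :=
  hist_event h `&` step_event (size h) (nth 0 h (size h - k.+1)) w k.

(** A history of length n+1 splits according to the time that is remembered. Once
   the first n steps are fixed, so is the remembered step, and each piece becomes
   the intersection of a past event with an event about the n-th source. *)
Lemma hist_event_cons (h : seq V) w : h != [::] ->
  hist_event (w :: h) = \big[setU/set0]_(k < size h) branch_event h w k.
Proof.
move=> h0; have n1 : (1 <= size h)%N by rewrite lt0n size_eq0.
rewrite -(bigcup_mkord _ (branch_event h w)); apply/seteqP; split=> x /=.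
  rewrite /hist_event /= => -[xw xh].
  have := erw_U_val walk x n1; case Uk : (U (size h) x) => [//|k] /= kn.
  exists k => //=; split => //; split => //=.
  by have := nth_hist x kn; rewrite xh => ->; rewrite -xw (erw_step walk x n1) Uk.
move=> [k /= kn] [xh [/= Uk Gw]]; rewrite /hist_event /= (erw_step walk x n1) Uk xh.
by congr (_ :: _); rewrite -Gw; have := nth_hist x kn; rewrite xh => ->.
Qed.

Lemma branch_event_trivIset (h : seq V) w : trivIset setT (branch_event h w).
Proof.
move=> i j _ _ [x [[_ [/= Ui _]] [_ [/= Uj _]]]].
by move: Ui; rewrite Uj => -[].
Qed.

Hypotheses (VoE : Vo = [fset - v | v in Ve]%fset) (Voe : (Vo `&` Ve)%fset = fset0).
Hypotheses (cVo : #|` Vo| = m) (cVe : #|` Ve| = m) (m2 : (2 <= m)%N).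
Hypotheses (hp : 0 <= p <= 1) (hq : 0 <= q <= 1).

Lemma valid_nth_mem h k : valid Vo Ve h -> h != [::] ->
  nth 0 h (size h - k.+1) \in (Vo `|` Ve)%fset.
Proof.
case: h => // v0 h vh _; rewrite inE; apply/orP; apply: (valid_mem vh).
by apply: mem_nth; rewrite /= subSS ltnS leq_subr.
Qed.

Lemma hist_event_past h : valid Vo Ve h -> past (size h) (hist_event h).
Proof.
elim: h => [_|w [|v0 h0] IH /andP[wW vh]].
- rewrite (_ : hist_event [::] = setT); last by apply/seteqP.
  exact: past0 (erw_indep walk).
- rewrite (_ : hist_event _ = setT `&` [set x | X 1%N x = w]).
    apply: pastS; [exact: innovation_measurable|exact: (past0 (erw_indep walk))|].
    by exists [set w]; [exact: vborel_set1 | rewrite setTI].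
  by apply/seteqP; split=> x; rewrite /hist_event /=; [case=> -> | case=> _ ->].
set h := v0 :: h0 in IH vh wW *; rewrite hist_event_cons//.
apply: past_bigsetU; [exact: innovation_measurable| |exact: branch_event_trivIset].
move=> k; apply: pastS; [exact: innovation_measurable|exact: IH|].
by apply: (step_event_innovation _ _ _ _).1 => //; exact: valid_nth_mem.
Qed.

(** The conditional law of the next step given the whole past. *)
Lemma hist_event_law h w : valid Vo Ve (w :: h) ->
  fine (P (hist_event (w :: h))) =
  fine (P (hist_event h)) * next_law Vo Ve m p q h w.
Proof.
case: h => [/andP[wW _]|v0 h0 /andP[wW vh]].
  rewrite (_ : hist_event [::] = setT); last by apply/seteqP.
  rewrite probability_setT mul1r (_ : hist_event _ = [set x | X 1%N x = w]).
    by rewrite (erw_X1_law walk).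
  by apply/seteqP; split=> x; rewrite /hist_event /=; [case=> -> | move=> ->].
set h := v0 :: h0 in vh wW *; rewrite hist_event_cons//.
have vh1 : valid Vo Ve h by [].
have pE := hist_event_past vh1.
have mB k : measurable (branch_event h w k).
  apply: measurableI; first by case: pE.
  apply: (@innovation_measurable (size h)).
  by apply: (step_event_innovation _ _ _ _).1 => //; exact: valid_nth_mem.
rewrite (measure_bigsetU _ mB); last exact: branch_event_trivIset.
rewrite (eq_bigr (fun k : 'I_(size h) => ((fine (P (hist_event h)) *
    ((size h)%:R^-1 * step_law m Vo Ve p q (size h).+1 (nth 0 h (size h - k.+1)) w))%:E))).
  (* positions in the history are counted backwards in time *)
  rewrite sumEFin /= -mulr_sumr -mulr_sumr; congr (_ * (_ * _)).
  rewrite [RHS](big_nth 0) big_mkord (reindex_inj rev_ord_inj).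
  by apply: eq_bigr => k _; rewrite [nat_of_ord (rev_ord k)]/= subnS subKn.
move=> k _; have vV := valid_nth_mem k vh1 isT.
have [hi se] := step_event_innovation w k (isT : (1 <= size h)%N) vV.
apply: etrans (pastI pE hi) _; rewrite se !EFinM fineK; last first.
  by rewrite fin_num_measure//; case: pE.
congr (_ * (_ * _))%E; first by apply: (erw_U_law walk); rewrite /= ltn_ord.
by apply: (erw_G_law walk).
Qed.


(** The possible histories of length n, so that a function of the history is a
   finite combination of indicators. *)
Fixpoint histories n : seq (seq V) :=
  if n is n'.+1 then [seq w :: h | h <- histories n', w <- W n'.+1] else [:: [::]].

Lemma historiesS n :
  histories n.+1 = [seq w :: h | h <- histories n, w <- W n.+1].
Proof. by []. Qed.

Lemma mem_histories n h : h \in histories n = valid Vo Ve h && (size h == n).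
Proof.
elim: n h => [|n IH] h; first by case: h => // w h; rewrite inE andbF.
rewrite historiesS; apply/allpairsPdep/andP => [[h' [w [hh wW ->]]]|].
  by move: hh; rewrite IH /= => /andP[-> /eqP ->]; rewrite wW.
case: h => [[_]|w h [/andP[wW vh]] /eqP [sh]]; first by [].
by exists h, w; split => //; [rewrite IH sh eqxx andbT | rewrite -sh].
Qed.

Lemma uniq_histories n : uniq (histories n).
Proof.
elim: n => // n IH; rewrite historiesS; apply: allpairs_uniq.
- exact: IH.
- exact: fset_uniq.
- by move=> [h w] [h' w'] _ _ [-> ->].
Qed.

Lemma hist_in_histories n x : hist n x \in histories n.
Proof. by rewrite mem_histories valid_hist size_hist eqxx. Qed.

Lemma histories_hexp n g :
  \sum_(h <- histories n) g h * fine (P (hist_event h)) = hexp Vo Ve m p q n g.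
Proof.
elim: n g => [|n IH] g.
  rewrite big_seq1 (_ : hist_event [::] = setT); last by apply/seteqP.
  by rewrite probability_setT mulr1.
rewrite hexpS -IH historiesS big_allpairs_dep; apply: eq_big_seq => h.
rewrite mem_histories => /andP[vh /eqP sh].
rewrite /cexp /next_mean mulr_suml sh; apply: eq_big_seq => w wW.
rewrite hist_event_law; last by rewrite /= sh wW.
by ring.
Qed.

Lemma hist_event_measurable h : valid Vo Ve h -> measurable (hist_event h).
Proof. by case/hist_event_past. Qed.

Lemma hist_indic n g x : g (hist n x) =
  \sum_(h <- histories n) g h * \1_(hist_event h) x.
Proof.
rewrite (bigD1_seq (hist n x)) ?hist_in_histories ?uniq_histories//=.
rewrite big_seq_cond big1 ?addr0.
  by rewrite indicE mem_set ?mulr1//= /hist_event /= size_hist.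
move=> h /andP[]; rewrite mem_histories => /andP[_ /eqP sh] hx.
rewrite indicE memNset ?mulr0// /hist_event /= sh => e; move: hx.
by rewrite e eqxx.
Qed.

Let weighted_indic (g : seq V -> R) h : Omega -> R := fun x => \1_(hist_event h) x * g h.

Lemma indic_Lfun h : valid Vo Ve h -> (\1_(hist_event h) : Omega -> R) \in Lfun P 1.
Proof.
by move=> vh; apply/Lfun1_integrable; apply: integrable_indic; exact: hist_event_measurable.
Qed.

Lemma weighted_indic_Lfun n g f :
  f \in [seq weighted_indic g h | h <- histories n] -> f \in Lfun P 1.
Proof.
move=> /mapP[h]; rewrite mem_histories => /andP[vh _] ->.
have -> : weighted_indic g h = g h *: (\1_(hist_event h) : Omega -> R).
  by apply/funext => x; rewrite /weighted_indic /= mulrC.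
by apply: rpredZ; exact: indic_Lfun.
Qed.

Lemma hist_sum_terms n g : (fun x => g (hist n x)) =
  \sum_(f <- [seq weighted_indic g h | h <- histories n]) f.
Proof.
apply/funext => x; rewrite hist_indic big_map fct_sumE.
by apply: eq_bigr => h _; rewrite /weighted_indic /= mulrC.
Qed.

Lemma hist_Lfun n g : (fun x => g (hist n x)) \in Lfun P 1.
Proof. by rewrite hist_sum_terms big_seq; apply: rpred_sum => f; exact: weighted_indic_Lfun. Qed.

Lemma expectation_hist n g :
  ('E_P[fun x => g (hist n x)] = (hexp Vo Ve m p q n g)%:E)%E.
Proof.
rewrite hist_sum_terms expectation_sum; last exact: weighted_indic_Lfun.
rewrite big_map -histories_hexp -sumEFin; apply: eq_big_seq => h.
rewrite mem_histories => /andP[vh _].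
rewrite [LHS](expectationZl (g h) (indic_Lfun vh)).
rewrite expectation_indic; last exact: hist_event_measurable.
by rewrite EFinM fineK// fin_num_measure//; exact: hist_event_measurable.
Qed.

Lemma hist_measurable_fun n g : measurable_fun setT (fun x => g (hist n x)).
Proof.
have /Lfun1_integrable/measurable_int := hist_Lfun n g.
by move/measurable_EFinP.
Qed.

Lemma hist_probability n (A : pred (seq V)) :
  P [set x | A (hist n x)] = (hexp Vo Ve m p q n (fun h => (A h)%:R))%:E.
Proof.
have mA : measurable [set x | A (hist n x)].
  have := hist_measurable_fun n (fun h => (A h)%:R) measurableT (measurable_set1 1).
  rewrite setTI (_ : _ @^-1` _ = [set x | A (hist n x)])//.
  apply/seteqP; split=> x /=; case: (A _) => //= /esym/eqP.
  by rewrite oner_eq0.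
rewrite -expectation_hist -expectation_indic//; congr expectation.
apply/funext => x; rewrite indicE; case: (boolP (A _)) => [Ax|/negP Ax].
  by rewrite mem_set.
by rewrite memNset.
Qed.

Lemma trunc_hist n N x : (n <= N)%N -> trunc n (hist N x) = hist n x.
Proof.
elim: N => [|N IH]; first by rewrite leqn0 => /eqP ->.
rewrite leq_eqVlt => /orP[/eqP ->|]; first by rewrite trunc_id ?size_hist.
by rewrite ltnS => nN; rewrite /= trunc_cons ?size_hist// IH.
Qed.

Lemma visited_hist n N A x : (n <= N)%N ->
  visited n A (hist N x) <-> exists k, [/\ (n <= k)%N, (k <= N)%N & A (hist k x)].
Proof.
elim: N => [|N IH] nN.
  rewrite /= orbF nN /=; split=> [A0|[k [_]]]; first by exists 0%N.
  by rewrite leqn0 => /eqP ->.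
rewrite [visited _ _ _]/= size_hist nN /=; split.
  move=> /orP[AN|vN]; first by exists N.+1.
  have nN' : (n <= N)%N.
    rewrite leqNgt; apply/negP => Nn; move: vN; rewrite (visited_lt A) ?size_hist//.
  by have [k [nk kN Ak]] := (IH nN').1 vN; exists k; split => //; exact: leqW.
move=> [k [nk]]; rewrite leq_eqVlt ltnS => /orP[/eqP -> Ak|kN Ak].
  by rewrite [X in X || _]Ak.
by apply/orP; right; apply/(IH (leq_trans nk kN)); exists k.
Qed.

End law_of_the_past.

(** * Limits of square-integrable random variables *)

Section mean_square_limits.
Context {R : realType} {disp : measure_display} {Omega : measurableType disp}.
Variable P : probability Omega R.
Implicit Types (f g : Omega -> R) (z : nat -> Omega -> R) (b : nat -> R).

Definition mean_square f : \bar R := ('E_P[fun x => (f x ^+ 2)%R])%E.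

Lemma mean_square_ge0 f : (0 <= mean_square f)%E.
Proof. by apply: expectation_ge0 => x; exact: sqr_ge0. Qed.

Lemma measurable_sqr f : measurable_fun setT f -> measurable_fun setT (fun x => f x ^+ 2).
Proof. by move=> mf; exact: measurable_funX. Qed.

Lemma mean_square_young f g (t : R) : measurable_fun setT f ->
  measurable_fun setT g -> 0 < t ->
  (mean_square f <= (1 + t)%:E * mean_square g +
     (1 + t^-1)%:E * mean_square (fun x => f x - g x)%R)%E.
Proof.
move=> mf mg t0; have t1 : 0 < t^-1 by rewrite invr_gt0.
have mfg : measurable_fun setT (fun x => (f x - g x) ^+ 2).
  by apply: measurable_sqr; exact: measurable_funB.
have mg2 := measurable_sqr mg; have mf2 := measurable_sqr mf.
rewrite /mean_square unlock -!ge0_integralZl_EFin//; first last.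
- by rewrite addr_ge0// ltW.
- exact/measurable_EFinP.
- by move=> x _; rewrite lee_fin sqr_ge0.
- by rewrite addr_ge0// ltW.
- exact/measurable_EFinP.
- by move=> x _; rewrite lee_fin sqr_ge0.
rewrite -ge0_integralD//; first last.
- apply: emeasurable_funM => //; exact/measurable_EFinP.
- by move=> x _; rewrite -EFinM lee_fin mulr_ge0 ?sqr_ge0// addr_ge0// ltW.
- apply: emeasurable_funM => //; exact/measurable_EFinP.
- by move=> x _; rewrite -EFinM lee_fin mulr_ge0 ?sqr_ge0// addr_ge0// ltW.
apply: ge0_le_integral => //.
- by move=> x _; rewrite lee_fin sqr_ge0.
- exact/measurable_EFinP.
- by apply: emeasurable_funD; apply: emeasurable_funM => //; exact/measurable_EFinP.
- by move=> x _; rewrite -!EFinM -EFinD lee_fin; exact: sqr_young.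
Qed.

Lemma mean_square_minkowski f g (c e : R) : measurable_fun setT f ->
  measurable_fun setT g -> (mean_square g <= c%:E)%E ->
  (mean_square (fun x => f x - g x)%R <= e%:E)%E ->
  mean_square f \is a fin_num /\
  Num.sqrt (fine (mean_square f)) <= Num.sqrt c + Num.sqrt e.
Proof.
move=> mf mg gc fge.
have c0 : 0 <= c by rewrite -lee_fin (le_trans (mean_square_ge0 g)).
have e0 : 0 <= e by rewrite -lee_fin (le_trans (mean_square_ge0 (fun x => f x - g x))).
have young t : 0 < t -> (mean_square f <= ((1 + t) * c + (1 + t^-1) * e)%:E)%E.
  move=> t0; apply: (le_trans (mean_square_young mf mg t0)); rewrite [leRHS]EFinD !EFinM.
  have t1 : 0 < t^-1 by rewrite invr_gt0.
  by apply: leeD; apply: lee_wpmul2l; rewrite // lee_fin addr_ge0// ltW.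
have ff : mean_square f \is a fin_num.
  by rewrite ge0_fin_numE ?mean_square_ge0// (le_lt_trans (young 1 _))// ltry.
split => //; apply: sqrt_triangle => // t t0; rewrite -lee_fin fineK//; exact: young.
Qed.

(** A maximal inequality whose bound vanishes forces almost sure convergence: the
   event that after every time n the sequence still makes a squared displacement
   of at least l is contained, for each n, in an event of probability at most
   b n / l. *)
Lemma ae_cauchy z b : (forall n, measurable_fun setT (z n)) -> b n @[n --> \oo] --> 0 ->
  (forall n N (l : R), (0 < n <= N)%N -> 0 < l ->
    (P [set x | exists k, [/\ (n <= k)%N, (k <= N)%N & (l <= (z k x - z n x) ^+ 2)%R]]
      <= (b n / l)%:E)%E) ->
  {ae P, forall x, cvgn (z^~ x)}.
Proof.
move=> mz b0 hmax.
pose A n l k := [set x | (n <= k)%N /\ l <= (z k x - z n x) ^+ 2].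
have mA n l k : measurable (A n l k).
  rewrite /A; case: (leqP n k) => nk; last first.
    by rewrite (_ : mkset _ = set0)//; apply/seteqP; split => x // [].
  rewrite (_ : mkset _ = (fun x => (z k x - z n x) ^+ 2) @^-1` `[l, +oo[).
    rewrite -[X in measurable X]setTI.
    by apply: (measurable_sqr (measurable_funB (mz k) (mz n))).
  by apply/seteqP; split => x /=; rewrite in_itv/= andbT; [case|].
have AP n l : (0 < n)%N -> 0 < l -> (P (\bigcup_k A n l k) <= (b n / l)%:E)%E.
  move=> n0 l0.
  pose B N := \big[setU/set0]_(k < N) A n l k.
  have BE N : B N = \bigcup_(k < N) A n l k by rewrite bigcup_mkord.
  have mB N : measurable (B N) by apply: bigsetU_measurable => k _; exact: mA.
  have cvgB : (P \o B) x @[x --> \oo] --> P (\bigcup_N B N).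
    apply: nondecreasing_cvg_mu => //; first exact: bigcup_measurable.
    by move=> i j ij; apply/subsetPset; exact: subset_bigsetU.
  have UB : \bigcup_N B N = \bigcup_k A n l k.
    apply/seteqP; split=> x [k _]; first by rewrite BE => -[j _ Aj]; exists j.
    by move=> Ak; exists k.+1 => //; rewrite BE; exists k => /=.
  rewrite UB in cvgB.
  apply: (cvge_to_le cvgB); exists n => // N /= nN.
  apply: le_trans (hmax n N l _ l0); last by rewrite n0.
  apply: le_measure; rewrite ?inE//.
    rewrite (_ : mkset _ = B N.+1); first exact: mB.
    rewrite BE; apply/seteqP; split => x /=.
      by move=> [k [nk kN lk]]; exists k.
    by move=> [k /= kN [nk lk]]; exists k.
  rewrite BE => x [k /= kN [nk lk]].
  by exists k; split => //; exact: ltnW.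
have neg l : 0 < l -> P.-negligible (\bigcap_(n in [set n | (0 < n)%N]) \bigcup_k A n l k).
  move=> l0; set S := \bigcap_(n in _) _.
  have mS : measurable S.
    apply: bigcap_measurable; first by exists 1%N.
    by move=> n _; apply: bigcup_measurable => k _; exact: mA.
  apply/negligibleP => //; apply/eqP; rewrite eq_le measure_ge0 andbT.
  have bl : (b n / l)%:E @[n --> \oo] --> 0%:E.
    apply: cvg_EFin; first by near=> n.
    rewrite -(mul0r l^-1); apply: cvgM => //; exact: cvg_cst.
  apply: (cvge_to_ge bl); exists 1%N => // n /= n1.
  apply: le_trans (AP n l n1 l0); apply: le_measure; rewrite ?inE//.
    by apply: bigcup_measurable => k _; exact: mA.
  by move=> x; apply.
have negall : P.-negligible (\bigcup_j \bigcap_(n in [set n | (0 < n)%N])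
    \bigcup_k A n (j.+1%:R^-1 ^+ 2) k).
  by apply: negligible_bigcup => j; apply: neg; rewrite exprn_gt0.
apply: (negligibleS _ negall) => x /= ncvg; apply: contrapT => hx; apply: ncvg.
apply/cauchy_cvgP/cauchy_exP => e e0.
have [j je] : exists j : nat, (j.+1%:R^-1 : R) < e.
  by have [j _ hj] := near_infty_natSinv_lt (PosNum e0); exists j; exact: (hj j (leqnn j)).
have : exists n, (0 < n)%N /\ forall k, (n <= k)%N -> (z k x - z n x) ^+ 2 < j.+1%:R^-1 ^+ 2.
  apply: contrapT => hn; apply: hx; exists j => // n /= n0; apply: contrapT => hk.
  apply: hn; exists n; split => // k nk; rewrite ltNge; apply/negP => lk.
  by apply: hk; exists k.
move=> [n [n0 hn]]; exists (z n x); exists n => // k /= nk.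
rewrite /ball /= distrC; apply: lt_trans je.
by rewrite -ltr_sqr ?nnegrE// real_normK ?num_real//; exact: hn.
Unshelve. all: by end_near. Qed.

(** The upper limit is measurable without any convergence assumption; [fine] gives
   it the value 0 where it is infinite. *)
Definition pointwise_limit z x : R := fine (limn_esup (fun n => (z n x)%:E)).

Lemma pointwise_limit_measurable z : (forall n, measurable_fun setT (z n)) ->
  measurable_fun setT (pointwise_limit z).
Proof.
move=> mz; apply: (measurableT_comp (f := fine)) => //.
by apply: measurable_fun_limn_esup => n; exact/measurable_EFinP.
Qed.

Lemma pointwise_limitP z x : cvgn (z^~ x) -> z n x @[n --> \oo] --> pointwise_limit z x.
Proof.
move=> zc; have h : (z n x)%:E @[n --> \oo] --> (limn (z^~ x))%:E.
  by apply: cvg_EFin => //; near=> n.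
by rewrite /pointwise_limit (cvg_limn_einf_sup h).2.
Unshelve. all: by end_near. Qed.

Lemma limn_einf_le (u : nat -> \bar R) (c : \bar R) :
  (forall n, u n <= c)%E -> (limn_einf u <= c)%E.
Proof.
move=> uc; rewrite limn_einf_lim; apply: lime_le; first exact: is_cvg_einfs.
by apply: nearW => n; apply: le_trans (uc n); apply: ereal_inf_lbound; exists n => /=.
Qed.

(** Fatou's lemma lets N tend to infinity in the mean square distance between the
   terms n and N. *)
Lemma mean_square_limit z (l : Omega -> R) n (e : R) :
  (forall n, measurable_fun setT (z n)) ->
  measurable_fun setT l -> {ae P, forall x, z n x @[n --> \oo] --> l x} ->
  (forall N, (n <= N)%N -> mean_square (fun x => z N x - z n x)%R <= e%:E)%E ->
  (mean_square (fun x => z n x - l x)%R <= e%:E)%E.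
Proof.
move=> mz ml zl hN.
pose f N x := (((z (N + n)%N x - z n x) ^+ 2)%R)%:E.
have mf N : measurable_fun setT (f N).
  apply/measurable_EFinP; apply: measurable_sqr; exact: measurable_funB.
have -> : mean_square (fun x => z n x - l x) = (\int[P]_x limn_einf (f^~ x))%E.
  rewrite /mean_square unlock; apply: ae_eq_integral => //.
  - by apply/measurable_EFinP; apply: measurable_sqr; exact: measurable_funB.
  - apply: (measurableT_comp (f := oppe)) => //.
    apply: measurable_fun_limn_esup => N.
    exact: (measurableT_comp (f := oppe)).
  apply: filterS zl => x zx _; rewrite -sqrrN opprB.
  have h : f N x @[N --> \oo] --> ((l x - z n x) ^+ 2)%:E.
    apply: cvg_EFin; first by near=> N.
    have h1 : (z (N + n)%N x - z n x) @[N --> \oo] --> l x - z n x.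
      by apply: cvgB; [move: zx; rewrite -(cvg_shiftn n) | exact: cvg_cst].
    exact: (cvgM h1 h1).
  by rewrite (cvg_limn_einf_sup h).1.
apply: (@le_trans _ _ (limn_einf (fun N => (\int[P]_x f N x)%E))).
  by apply: fatou => // N x _; rewrite lee_fin sqr_ge0.
apply: limn_einf_le => N; have := hN _ (leq_addl N n).
by rewrite /mean_square unlock.
Unshelve. all: by end_near. Qed.

Lemma mean_square_cvg z (l : Omega -> R) (a b : nat -> R) (C : R) :
  (forall n, measurable_fun setT (z n)) -> measurable_fun setT l ->
  (forall n, mean_square (z n) = (a n)%:E) ->
  a n @[n --> \oo] --> C ->
  (forall n, (0 < n)%N -> mean_square (fun x => z n x - l x)%R <= (b n)%:E)%E ->
  b n @[n --> \oo] --> 0 ->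
  mean_square l = C%:E.
Proof.
move=> mz ml za aC zl b0.
have symm n : mean_square (fun x => l x - z n x) = mean_square (fun x => z n x - l x).
  by rewrite /mean_square; congr expectation; apply/funext => x; rewrite -sqrrN opprB.
have lz n : (0 < n)%N -> mean_square l \is a fin_num /\
    Num.sqrt (fine (mean_square l)) <= Num.sqrt (a n) + Num.sqrt (b n).
  by move=> n0; apply: (mean_square_minkowski ml (mz n)); rewrite ?za ?symm// zl.
have fl : mean_square l \is a fin_num := (lz 1%N isT).1.
have zl' n : (0 < n)%N ->
    Num.sqrt (a n) <= Num.sqrt (fine (mean_square l)) + Num.sqrt (b n).
  move=> n0; have [_] := mean_square_minkowski (mz n) ml (c := fine (mean_square l)) (e := b n)
    (eq_ind_r (fun y => (_ <= y)%E) (lexx _) (fineK fl)) (zl n n0).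
  by rewrite za.
have sa : Num.sqrt (a n) @[n --> \oo] --> Num.sqrt (fine (mean_square l)).
  apply/cvgrPdist_le => e e0; have := sqrt_cvg0 b0.
  move/cvgr0Pnorm_le => /(_ e e0) [n0 _ hn]; exists n0.+1 => // n /= n0n.
  have := hn n (ltnW n0n); rewrite /= ger0_norm ?sqrtr_ge0// => be.
  have n1 : (0 < n)%N by exact: leq_ltn_trans n0n.
  by rewrite ler_distl; have := (lz n n1).2; have := zl' n n1 => h1 h2; apply/andP; split; lra.
have sC : Num.sqrt (a n) @[n --> \oo] --> Num.sqrt C.
  by apply: (continuous_cvg _ _ aC); exact: sqrt_continuous.
have C0 : 0 <= C.
  apply: (cvgr_to_ge aC); apply: nearW => n.
  by rewrite -lee_fin -za mean_square_ge0.
have sE : Num.sqrt (fine (mean_square l)) = Num.sqrt C.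
  exact: (cvg_unique (@norm_hausdorff R R^o) sa sC).
rewrite -(fineK fl) -(sqr_sqrtr C0) -sE sqr_sqrtr//.
by rewrite fine_ge0// mean_square_ge0.
Qed.

Lemma mean_square_Lfun2 f : measurable_fun setT f ->
  (mean_square f < +oo)%E -> f \in Lfun P 2%:E.
Proof.
move=> mf ff; rewrite inE; apply/andP; split; rewrite inE//=.
rewrite /finite_norm unlock /Lnorm.
apply: poweR_lty; apply: le_lt_trans ff; rewrite /mean_square unlock.
rewrite le_eqVlt; apply/orP; left; apply/eqP; apply: eq_integral => x _.
by rewrite /= powR_mulrn// real_normK ?num_real.
Qed.

(** The variance is nonnegative. *)
Lemma expectation_sqr_le f (e : R) : measurable_fun setT f ->
  (mean_square f <= e%:E)%E -> fine ('E_P[f])%E ^+ 2 <= e.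
Proof.
move=> mf fe; have f2 : f \in Lfun P 2%:E.
  by apply: mean_square_Lfun2 => //; rewrite (le_lt_trans fe)// ltry.
have f1 : f \in Lfun P 1 by apply: Lfun_subset12 f2; rewrite fin_num_measure.
have := variance_ge0 P f; rewrite varianceE//.
have fE := expectation_fin_num f1.
rewrite -(fineK fE) -EFin_expe sube_ge0 ?fin_numE// => h.
by rewrite -lee_fin (le_trans h).
Qed.

(** The expectation of the limit is minus that of the error z n - l, whose square
   is at most the mean square error. *)
Lemma expectation_limit0 z (l : Omega -> R) b :
  (forall n, z n \in Lfun P 1) -> measurable_fun setT l ->
  (forall n, 'E_P[z n] = 0)%E ->
  (forall n, (0 < n)%N -> mean_square (fun x => z n x - l x)%R <= (b n)%:E)%E ->
  b n @[n --> \oo] --> 0 ->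
  ('E_P[l] = 0)%E.
Proof.
move=> z1 ml z0 zl b0.
have mz n : measurable_fun setT (z n).
  by have /Lfun1_integrable/measurable_int/measurable_EFinP := z1 n.
have myn n : measurable_fun setT (fun x => z n x - l x) by exact: measurable_funB.
have y1 n : (0 < n)%N -> (fun x => z n x - l x) \in Lfun P 1.
  move=> n0; apply: Lfun_subset12; first by rewrite fin_num_measure.
  by apply: mean_square_Lfun2 => //; rewrite (le_lt_trans (zl n n0))// ltry.
have l1 : l \in Lfun P 1.
  rewrite (_ : l = z 1%N - (fun x => z 1%N x - l x)); first by apply: rpredB => //; exact: y1.
  by apply/funext => x; rewrite !fctE subKr.
have yE n : (0 < n)%N -> fine ('E_P[fun x => z n x - l x]%R)%E = - fine ('E_P[l])%E.
  move=> n0; have := expectationB (z1 n) l1; rewrite z0 sub0e => e.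
  by rewrite [X in fine X]e fineN.
have l0 : fine ('E_P[l])%E ^+ 2 <= 0.
  apply: (cvgr_to_ge b0); exists 1%N => // n /= n0.
  by rewrite -sqrrN -(yE n n0); apply: expectation_sqr_le; rewrite ?zl.
rewrite -(fineK (expectation_fin_num l1)); congr EFin.
by apply/eqP; rewrite -sqrf_eq0 eq_le l0 sqr_ge0.
Qed.
End mean_square_limits.

(** * Random vectors from their coordinates *)

Definition rational_box (R : realType) d (qk : 'rV[rat]_d * nat) : set 'rV[R]_d :=
  [set v | forall j, `|v ord0 j - ratr (qk.1 ord0 j)| < qk.2.+1%:R^-1].

Lemma open_rational_boxes (R : realType) d (A : set 'rV[R]_d) v : open A -> A v ->
  exists qk, rational_box qk v /\ rational_box qk `<=` A.
Proof.
move=> oA Av; have /nbhs_ballP[e /= e0 eA] : nbhs v A by exact: open_nbhs_nbhs.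
(* half the radius: a box around a rational point close to v has twice the size *)
have e2 : 0 < e / 2 by rewrite divr_gt0.
have [k _ hk] := near_infty_natSinv_lt (PosNum e2).
have {}hk : k.+1%:R^-1 < e / 2 := hk k (leqnn k).
have k0 : 0 < k.+1%:R^-1 :> R by rewrite invr_gt0.
have hq (j : 'I_d) : exists r : rat, `|v ord0 j - ratr r| < k.+1%:R^-1.
  have vk : v ord0 j - k.+1%:R^-1 < v ord0 j + k.+1%:R^-1 by rewrite ltrD2l gtrN.
  have [r] := rat_in_itvoo vk; rewrite in_itv/= => rv.
  by exists r; rewrite ltr_distlC.
have [r hr] := choice hq.
exists (\row_j r j, k); split; first by move=> j /=; rewrite mxE.
move=> w hw; apply: eA; rewrite /ball /=; split => // i j; rewrite (ord1 i) /ball /=.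
have := hr j; have := hw j; rewrite /= mxE => h1 h2.
rewrite (_ : v ord0 j - w ord0 j = (v ord0 j - ratr (r j)) - (w ord0 j - ratr (r j))).
  rewrite (le_lt_trans (ler_normB _ _))// [e]splitr ltrD//.
    by apply: lt_trans hk.
  by apply: lt_trans hk.
by ring.
Qed.

(** An open set is a countable union of rational boxes, and the preimage of a box
   is a finite intersection of preimages of intervals. *)
Lemma random_vector_coordinates (R : realType) disp (Omega : measurableType disp) d
    (Z : Omega -> 'rV[R]_d) :
  (forall i, measurable_fun setT (fun x => Z x ord0 i)) -> random_vector Z.
Proof.
move=> mZ B; apply: (@smallest_sub _ _ _ [set B | measurable (Z @^-1` B)]).
  split.
  - by rewrite /= preimage_set0.
  - by move=> A mA; rewrite /= setTD preimage_setC; exact: measurableC.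
  - by move=> F mF; rewrite /= preimage_bigcup; apply: bigcup_measurable => k _; exact: mF.
move=> A oA /=.
have mbox qk : measurable (Z @^-1` (@rational_box R d qk)).
  rewrite (_ : _ @^-1` _ = \bigcap_(j in [set: 'I_d])
      ((fun x => `|Z x ord0 j - ratr (qk.1 ord0 j)|) @^-1` `]-oo, qk.2.+1%:R^-1[)).
    apply: fin_bigcap_measurable => //.
    move=> j _; rewrite -[X in measurable X]setTI.
    have mf : measurable_fun setT (fun x => `|Z x ord0 j - ratr (qk.1 ord0 j)|).
      by apply: (measurableT_comp (@normr_measurable R setT)); apply: measurable_funB.
    exact: mf.
  by apply/seteqP; split=> x hx j; have := hx j; rewrite /= in_itv/=; [move=> h _|apply].
pose F (n : nat) := oapp (fun qk : 'rV[rat]_d * nat =>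
  if `[< @rational_box R d qk `<=` A >] then Z @^-1` (@rational_box R d qk)
  else set0) set0 (choice.unpickle n).
rewrite (_ : Z @^-1` A = \bigcup_n F n).
  by apply: bigcup_measurable => n _; rewrite /F; case: (choice.unpickle n) => //= qk; case: ifP.
apply/seteqP; split=> [x /= Ax|x [n _]].
  have [qk [h1 h2]] := open_rational_boxes oA Ax.
  by exists (choice.pickle qk) => //; rewrite /F choice.pickleK/= asboolT.
by rewrite /F; case: (choice.unpickle n) => //= qk; case: ifP => // /asboolP h; exact: h.
Qed.

(** * The limit of the rescaled walk *)

Lemma cvg_finite_sum (R : realType) (I : Type) (r : seq I) (u : I -> nat -> R) (l : I -> R) :
  (forall i, u i n @[n --> \oo] --> l i) ->
  \sum_(i <- r) u i n @[n --> \oo] --> \sum_(i <- r) l i.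
Proof.
move=> ul; elim: r => [|i r IH].
  by rewrite big_nil; under eq_fun do rewrite big_nil; exact: cvg_cst.
by rewrite big_cons; under eq_fun do rewrite big_cons; apply: cvgD.
Qed.

Section limit_of_the_walk.
Context {R : realType} {d : nat}.
Variables (Vo Ve : {fset 'rV[R]_d}) (m : nat) (p q : R).
Local Notation V := 'rV[R]_d.
Local Notation delta := (elephant_delta m p q).
Hypotheses (VoE : Vo = [fset - v | v in Ve]%fset) (Voe : (Vo `&` Ve)%fset = fset0).
Hypotheses (cVo : #|` Vo| = m) (cVe : #|` Ve| = m) (m2 : (2 <= m)%N).
Hypotheses (hp : 0 <= p <= 1) (hq : 0 <= q <= 1).
Hypothesis hdelta : 1 / 2 < delta < 1.

Definition mean_coord (i : 'I_d) : R := avg m Vo (fun w => w ord0 i).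
(** The mean of V_e is the opposite of the mean of V_o. *)
Definition psi (i : 'I_d) (v : V) : R := v ord0 i - sgn Vo v * mean_coord i.

Lemma psi_odd i : {in Ve, forall v, psi i (- v) = - psi i v}.
Proof.
move=> v vE; rewrite /psi mxE /sgn (opp_Vo VoE) vE (Ve_notin_Vo Voe vE).
by rewrite mul1r mulN1r; ring.
Qed.

Lemma psi_sum0 i : \sum_(w <- Vo) psi i w = 0.
Proof.
rewrite (eq_big_seq (fun w : V => w ord0 i - mean_coord i)); last first.
  by move=> w wV; rewrite /psi /sgn wV mul1r.
rewrite sumrB big_const_seq count_predT iter_addr_0 cVo /mean_coord /avg.
rewrite -[X in _ - X]mulr_natl mulrA mulfV ?mul1r ?subrr//.
by rewrite pnatr_eq0 -lt0n ltnW.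
Qed.

(** If all coordinates were constant on V_o, then V_o would have a single element. *)
Lemma step_variance_gt0 : exists i, 0 < step_variance Vo m (psi i).
Proof.
apply: contrapT => h.
have v0 i : step_variance Vo m (psi i) = 0.
  apply/eqP; rewrite eq_le step_variance_ge0 andbT leNgt; apply/negP => hi.
  by apply: h; exists i.
have coordE (w : V) i : w \in Vo -> w ord0 i = mean_coord i.
  move=> wV; have /eqP := v0 i; rewrite /step_variance /avg mulf_eq0 invr_eq0.
  rewrite pnatr_eq0 eqn0Ngt (ltnW m2)/= psumr_eq0; last by move=> *; exact: sqr_ge0.
  move=> /allP /(_ w wV); rewrite /= sqrf_eq0 /psi /sgn wV mul1r subr_eq0.
  by move/eqP.
have [w wV] : exists w, w \in Vo.
  by apply/fset0Pn; rewrite -cardfs_gt0 cVo ltnW.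
have : (#|` Vo| <= #|` [fset w]%fset|)%N.
  apply: fsubset_leq_card; apply/fsubsetP => w' wV'; rewrite inE; apply/eqP.
  by apply/rowP => i; rewrite !coordE.
by rewrite cardfs1 cVo leqNgt m2.
Qed.

(** Written without reference to any probability space: the constant has to be the
   same for all realizations of the walk. *)
Definition limit_constant : R := \sum_(i < d) limit_variance Vo Ve m p q (psi i).

Lemma limit_constant_gt0 : 0 < limit_constant.
Proof.
have [i vi] := step_variance_gt0.
rewrite /limit_constant (bigD1 i)//= ltr_pwDl//; last first.
  by apply: sumr_ge0 => j _; exact: limit_variance_ge0.
exact: (limit_variance_gt0 VoE Voe cVo cVe m2 hp hq hdelta (@psi_odd i) (psi_sum0 i) vi).
Qed.

Lemma modulus_psi_cvg0 i : modulus Vo m p q (psi i) n @[n --> \oo] --> 0.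
Proof. exact: modulus_cvg0. Qed.

Context {disp : measure_display} {Omega : measurableType disp}.
Variables (P : probability Omega R) (X : nat -> Omega -> V)
  (U : nat -> Omega -> nat) (G : nat -> V -> Omega -> V).
Hypothesis walk : elephant_walk P m Vo Ve p q X U G.

Local Notation hist := (hist X).
Local Notation corrected i := (corrected Vo m p q (psi i)).
Local Notation modulus i := (modulus Vo m p q (psi i)).
Local Notation rt := (rate m p q).
Local Notation centred i := (plain_sum (psi i)).

Definition limit_coord i : Omega -> R := pointwise_limit (fun n x => corrected i (hist n x)).

Lemma limit_coord_measurable i : measurable_fun setT (limit_coord i).
Proof. by apply: pointwise_limit_measurable => n; exact: (hist_measurable_fun walk). Qed.

Lemma corrected_cvg i :
  {ae P, forall x, corrected i (hist n x) @[n --> \oo] --> limit_coord i x}.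
Proof.
have hmax n N (l : R) : (0 < n <= N)%N -> 0 < l ->
  (P [set x | exists k, [/\ (n <= k)%N, (k <= N)%N &
     (l <= (corrected i (hist k x) - corrected i (hist n x)) ^+ 2)%R]] <=
     (modulus i n / l)%:E)%E.
  move=> nN l0; have := corrected_maximal VoE Voe cVo cVe m2 hp hq hdelta
    (@psi_odd i) (psi_sum0 i) nN l0.
  set A := (X in visited n X).
  rewrite -lee_fin -(hist_probability walk); apply: le_trans.
  rewrite (_ : mkset _ = [set x | visited n A (hist N x)])//.
  have nN' : (n <= N)%N by case/andP: nN.
  apply/seteqP; split=> x /=.
    move=> [k [nk kN lk]]; apply/(visited_hist X A x nN'); exists k; split => //.
    by rewrite /A trunc_hist.
  move=> /(visited_hist X A x nN') [k [nk kN]]; rewrite /A trunc_hist// => lk.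
  by exists k.
have := ae_cauchy (fun n => hist_measurable_fun walk n (corrected i)) (modulus_psi_cvg0 i) hmax.
by apply: filterS => x; exact: pointwise_limitP.
Qed.

Lemma corrected_mean_square i n : (0 < n)%N ->
  (mean_square P (fun x => corrected i (hist n x) - limit_coord i x)%R
    <= (modulus i n)%:E)%E.
Proof.
move=> n0; apply: (mean_square_limit (z := fun n x => corrected i (hist n x))).
- by move=> k; exact: (hist_measurable_fun walk).
- exact: limit_coord_measurable.
- exact: corrected_cvg.
move=> N nN; rewrite /mean_square.
have := corrected_increment VoE Voe cVo cVe m2 hp hq hdelta (@psi_odd i) (psi_sum0 i)
  (n := n) (N := N); rewrite n0 nN => /(_ isT).
rewrite -lee_fin -(expectation_hist walk); apply: le_trans.
rewrite (_ : (fun x => (corrected i (hist N x) - _) ^+ 2) =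
  (fun x => (corrected i (hist N x) - corrected i (trunc n (hist N x))) ^+ 2))//.
by apply/funext => x; rewrite trunc_hist.
Qed.

Lemma limit_coord_expectation i : ('E_P[limit_coord i] = 0)%E.
Proof.
apply: (expectation_limit0 (z := fun n x => corrected i (hist n x)) (b := modulus i)).
- by move=> n; exact: (hist_Lfun walk).
- exact: limit_coord_measurable.
- move=> n; rewrite (expectation_hist walk).
  by rewrite (hexp_corrected p q VoE Voe cVo cVe m2 (@psi_odd i) (psi_sum0 i)).
- exact: corrected_mean_square.
- exact: modulus_psi_cvg0.
Qed.

Lemma limit_coord_mean_square i :
  mean_square P (limit_coord i) = (limit_variance Vo Ve m p q (psi i))%:E.
Proof.
apply: (mean_square_cvg (z := fun n x => corrected i (hist n x)) (b := modulus i)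
  (a := fun n => hexp Vo Ve m p q n (fun h => corrected i h ^+ 2))).
- by move=> n; exact: (hist_measurable_fun walk).
- exact: limit_coord_measurable.
- by move=> n; rewrite /mean_square (expectation_hist walk n (fun h => corrected i h ^+ 2)).
- exact: (hexp_corrected_sqr_cvg VoE Voe cVo cVe m2 hp hq hdelta (@psi_odd i) (psi_sum0 i)).
- exact: corrected_mean_square.
- exact: modulus_psi_cvg0.
Qed.

(** The means of successive steps cancel, so only the last one can remain. *)
Definition parity_mean i n : R := if odd n then mean_coord i else 0.

Lemma position_coord i n x :
  position X n x ord0 i = centred i (hist n x) + parity_mean i n.
Proof.
elim: n => [|n IH]; first by rewrite /= mxE /plain_sum big_nil addr0.
rewrite /= mxE IH /plain_sum big_cons /psi (sgn_W Voe (walk_in_steps walk n x)).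
rewrite /eps -signr_odd /parity_mean /=; case: (odd n) => /=; rewrite ?expr0 ?expr1; ring.
Qed.

Lemma second_moment_coord (Y : Omega -> V) :
  (forall i, measurable_fun setT (fun x => Y x ord0 i)) ->
  second_moment P Y = (\sum_(i < d) mean_square P (fun x => Y x ord0 i))%E.
Proof.
move=> mY; rewrite /second_moment /mean_square unlock.
rewrite -ge0_integral_sum//; last 2 first.
- by move=> i; apply/measurable_EFinP; exact: measurable_sqr.
- by move=> i x _; rewrite lee_fin sqr_ge0.
apply: eq_integral => x _; rewrite /enorm sqr_sqrtr ?sumEFin//.
by apply: sumr_ge0 => i _; rewrite sqr_ge0.
Qed.

Lemma vexpectation_coord i n :
  vexpectation P (position X n) ord0 i = parity_mean i n.
Proof.
rewrite mxE; under eq_fun do rewrite position_coord.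
rewrite (expectation_hist walk n (fun h => centred i h + parity_mean i n)) /=.
rewrite hexpD (hexp_cst p q VoE cVo cVe m2).
by rewrite (hexp_plain_alternating p q VoE Voe cVo cVe m2 (@psi_odd i) (psi_sum0 i) n).1 add0r.
Qed.

Lemma centred_second_moment n :
  second_moment P (fun x => position X n x - vexpectation P (position X n)) =
  (\sum_(i < d) hexp Vo Ve m p q n (fun h => centred i h ^+ 2))%:E.
Proof.
have coordE i x : (position X n x - vexpectation P (position X n)) ord0 i =
    centred i (hist n x).
  by rewrite mxE [X in _ + X]mxE vexpectation_coord position_coord addrK.
rewrite second_moment_coord; last first.
  move=> i; under eq_fun do rewrite coordE.
  exact: (hist_measurable_fun walk).
rewrite -sumEFin; apply: eq_bigr => i _; rewrite /mean_square.
under eq_fun do rewrite coordE.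
by rewrite (expectation_hist walk n (fun h => centred i h ^+ 2)).
Qed.

Lemma variance_asymp : asymp_equiv
  (fun n => fine (second_moment P
     (fun x => position X n x - vexpectation P (position X n))))
  (fun n => limit_constant * n%:R `^ (2 * delta)).
Proof.
rewrite /asymp_equiv.
have h : (\sum_(i < d) hexp Vo Ve m p q n (fun h => (rt n * centred i h) ^+ 2))
    @[n --> \oo] --> limit_constant.
  apply: cvg_finite_sum => i.
  exact: (plain_sum_variance_cvg VoE Voe cVo cVe m2 hp hq hdelta (@psi_odd i) (psi_sum0 i)).
have C0 : limit_constant != 0 by rewrite gt_eqF// limit_constant_gt0.
have {}h : ((\sum_(i < d) hexp Vo Ve m p q n (fun h => (rt n * centred i h) ^+ 2)) / limit_constant)
    @[n --> \oo] --> (1 : R).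
  by rewrite -(divff C0); apply: cvgMl.
apply: cvg_trans h; apply: near_eq_cvg; near=> n.
have n0 : (0 < n)%N by near: n; exists 1%N.
have n0R : 0 < n%:R :> R by rewrite ltr0n.
rewrite centred_second_moment /= [_ * _ `^ _]mulrC invfM mulrA; congr (_ / _).
rewrite mulr_suml; apply: eq_bigr => i _.
rewrite (_ : (fun h => (rt n * centred i h) ^+ 2) =
    (fun h => rt n ^+ 2 * centred i h ^+ 2)); last by apply/funext => h; rewrite exprMn.
rewrite hexpZ mulrC; congr (_ * _).
by rewrite expr2 /rate -decayD// /decay -powRN; congr powR; ring.
Unshelve. all: by end_near. Qed.

Definition limit_vector x : V := \row_i limit_coord i x.

Lemma limit_vector_measurable : random_vector limit_vector.
Proof.
apply: random_vector_coordinates => i.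
by under eq_fun do rewrite mxE; exact: limit_coord_measurable.
Qed.

Definition scaled n x : V := (n%:R `^ delta)^-1 *: position X n x.

Lemma scaled_coord n x i :
  scaled n x ord0 i = rt n * (centred i (hist n x) + parity_mean i n).
Proof. by rewrite mxE position_coord -powRN. Qed.

Lemma scaled_measurable n i : measurable_fun setT (fun x => scaled n x ord0 i).
Proof.
under eq_fun do rewrite scaled_coord.
exact: (hist_measurable_fun walk n (fun h => rt n * (centred i h + parity_mean i n))).
Qed.

Definition scaling_error i n : R := (step_bound Vo (psi i) + `|mean_coord i|) * rt n.

Lemma scaled_near_corrected n x i : (0 < n)%N ->
  `|scaled n x ord0 i - corrected i (hist n x)| <= scaling_error i n.
Proof.
move=> n0; rewrite scaled_coord mulrDr addrAC /scaling_error mulrDl.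
apply: (le_trans (ler_normD _ _)); apply: lerD.
  have := plain_sum_near_corrected VoE m2 hp hq hdelta (@psi_odd i) (valid_hist walk n x).
  by rewrite size_hist; exact.
have r0 : 0 <= rt n by rewrite ltW// decay_gt0.
rewrite normrM (ger0_norm r0) mulrC ler_wpM2r// /parity_mean.
by case: ifP; rewrite ?normr0.
Qed.

Lemma scaling_error_cvg0 i : scaling_error i n @[n --> \oo] --> 0.
Proof.
rewrite -(mulr0 (step_bound Vo (psi i) + `|mean_coord i|)); apply: cvgMr.
by apply: decay_cvg0; case/andP: hdelta => h _; lra.
Qed.

Lemma scaled_cvg :
  {ae P, forall x, (fun n => scaled n x) @ \oo --> limit_vector x}.
Proof.
have hall : {ae P, forall x, forall i,
    corrected i (hist n x) @[n --> \oo] --> limit_coord i x}.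
  by apply: filter_forall => i; exact: corrected_cvg.
apply: filterS hall => x hx.
have hc i : scaled n x ord0 i @[n --> \oo] --> limit_coord i x.
  have e0 : (scaled n x ord0 i - corrected i (hist n x)) @[n --> \oo] --> 0.
    apply/cvgr0Pnorm_le => e e0; move/cvgr0Pnorm_le: (scaling_error_cvg0 i) => /(_ e e0).
    move=> [n0 _ hn]; exists n0.+1 => // n /= nn.
    have n1 : (0 < n)%N by exact: leq_ltn_trans nn.
    apply: (le_trans (scaled_near_corrected x i n1)).
    by apply: (le_trans (ler_norm _)); exact: (hn n (ltnW nn)).
  rewrite -[X in _ --> X]add0r.
  rewrite (_ : (fun n => _) = (fun n => (scaled n x ord0 i - corrected i (hist n x)) +
     corrected i (hist n x))); last by apply/funext => n; rewrite subrK.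
  exact: cvgD.
apply/cvg_ballP => e e0.
have hn : \forall n \near \oo, forall i, `|limit_coord i x - scaled n x ord0 i| < e.
  by apply: filter_forall => i; have /cvgrPdist_lt := hc i; exact.
apply: filterS hn => n hn; split => // i j; rewrite (ord1 i) mxE; exact: hn.
Qed.

Lemma scaled_mean_square_cvg :
  (fun n => second_moment P (fun x => scaled n x - limit_vector x)) @ \oo --> 0%E.
Proof.
have coordE n i x : (scaled n x - limit_vector x) ord0 i = scaled n x ord0 i - limit_coord i x.
  by rewrite mxE [X in _ + X]mxE [limit_vector x _ _]mxE.
have mY n i : measurable_fun setT (fun x => (scaled n x - limit_vector x) ord0 i).
  under eq_fun do rewrite coordE.
  by apply: measurable_funB; [exact: scaled_measurable | exact: limit_coord_measurable].
pose err n := \sum_(i < d) (2 * modulus i n + 2 * scaling_error i n ^+ 2).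
have err0 : err n @[n --> \oo] --> (0 : R).
  have -> : (0 : R) = \sum_(i < d) (2 * 0 + 2 * (0 * 0)) by rewrite !mulr0 addr0 sumr_const mul0rn.
  apply: cvg_finite_sum => i; apply: cvgD; apply: cvgMr.
    exact: modulus_psi_cvg0.
  by apply: cvgM; exact: scaling_error_cvg0.
apply: (@squeeze_cvge _ _ _ _ (cst 0%E) _ (fun n => (err n)%:E)).
- exists 1%N => // n /= n0; rewrite second_moment_coord//; apply/andP; split.
    by apply: sume_ge0 => i _; exact: mean_square_ge0.
  rewrite /err -sumEFin; apply: lee_sum => i _.
  have mz : measurable_fun setT (fun x => corrected i (hist n x)).
    exact: (hist_measurable_fun walk).
  have ml := limit_coord_measurable i.
  have -> : mean_square P (fun x => (scaled n x - limit_vector x) ord0 i) =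
      mean_square P (fun x => scaled n x ord0 i - limit_coord i x).
    by congr mean_square; apply/funext => x; rewrite coordE.
  have := mean_square_young P (f := fun x => scaled n x ord0 i - limit_coord i x)
    (g := fun x => corrected i (hist n x) - limit_coord i x) _ _ (ltr01 : 0 < 1).
  move=> /(_ (measurable_funB (scaled_measurable n i) ml) (measurable_funB mz ml)).
  rewrite invr1 -[1 + 1]/2 => /le_trans; apply.
  rewrite [leRHS](_ : _ = 2%:E * (modulus i n)%:E + 2%:E * (scaling_error i n ^+ 2)%:E)%E;
    last by rewrite -!EFinM -EFinD.
  apply: leeD.
    by apply: lee_wpmul2l; rewrite ?lee_fin//; exact: corrected_mean_square.
  apply: lee_wpmul2l; rewrite ?lee_fin//.
  rewrite /mean_square -(expectation_cst P (scaling_error i n ^+ 2)).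
  apply: expectation_le => //.
  + apply: measurable_sqr; apply: measurable_funB; apply: measurable_funB => //.
    exact: scaled_measurable.
  + by move=> x; rewrite sqr_ge0.
  + by move=> x; rewrite sqr_ge0.
  + apply: aeW => x /=; rewrite opprB addrA subrK -real_normK ?num_real//.
    by rewrite lerXn2r ?nnegrE ?scaled_near_corrected// (le_trans _ (scaled_near_corrected x i n0)).
- exact: cvg_cst.
- by apply: cvg_EFin err0; near=> n.
Unshelve. all: by end_near. Qed.

Lemma limit_vector_expectation i : ('E_P[fun x => limit_vector x ord0 i] = 0)%E.
Proof. by under eq_fun do rewrite mxE; exact: limit_coord_expectation. Qed.

Lemma limit_vector_second_moment : second_moment P limit_vector = limit_constant%:E.
Proof.
rewrite second_moment_coord; last first.
  by move=> i; under eq_fun do rewrite mxE; exact: limit_coord_measurable.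
rewrite /limit_constant -sumEFin; apply: eq_bigr => i _.
by rewrite -limit_coord_mean_square; congr mean_square; apply/funext => x; rewrite mxE.
Qed.

(** An almost surely constant limit would equal its expectation 0, and its second
   moment would vanish. *)
Lemma limit_vector_not_constant : ~ exists c : V, {ae P, forall x, limit_vector x = c}.
Proof.
move=> [c hc].
have coord i (f : R -> R) : measurable_fun setT f ->
    ('E_P[fun x => f (limit_coord i x)] = (f (c ord0 i))%:E)%E.
  move=> mf; rewrite -(expectation_cst P (f (c ord0 i))) unlock.
  apply: ae_eq_integral => //.
    by apply/measurable_EFinP; exact: measurableT_comp (limit_coord_measurable i).
    by apply/measurable_EFinP; exact: measurable_cst.
  by apply: filterS hc => x <- _; rewrite mxE.
have c0 i : c ord0 i = 0.
  by have := coord i id (@measurable_id _ _ _); rewrite limit_coord_expectation => -[].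
have := limit_constant_gt0; rewrite /limit_constant big1 ?ltxx// => i _.
apply: EFin_inj; rewrite -limit_coord_mean_square /mean_square.
by rewrite (coord i (fun y => y ^+ 2)) ?c0 ?expr0n//; exact: measurable_sqr.
Qed.

End limit_of_the_walk.

Unset Implicit Arguments.

Theorem theorem2p18 (R : realType) (d : nat) (hd : (1 <= d)%N)
    (Se So : set 'rV[R]_d) (Vo Ve : {fset 'rV[R]_d})
    (hV : step_structure Se So Vo Ve)
    (m : nat) (hVo : #|` Vo| = m) (hVe : #|` Ve| = m) (hm : (2 <= m)%N)
    (p q : R) (hp : 0 <= p <= 1) (hq : 0 <= q <= 1)
    (hdelta : 1 / 2 < elephant_delta m p q < 1) :
  exists C : R, 0 < C /\
    forall (disp : measure_display) (Omega : measurableType disp)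
      (P : probability Omega R) (X : nat -> Omega -> 'rV[R]_d)
      (U : nat -> Omega -> nat) (G : nat -> 'rV[R]_d -> Omega -> 'rV[R]_d),
    elephant_walk P m Vo Ve p q X U G ->
    asymp_equiv
      (fun n => fine (second_moment P
         (fun x => position X n x - vexpectation P (position X n))))
      (fun n => C * n%:R `^ (2 * elephant_delta m p q)) /\
    exists L : Omega -> 'rV[R]_d,
      [/\ random_vector L,
          {ae P, forall x,
             (fun n => (n%:R `^ elephant_delta m p q)^-1 *: position X n x)
               @ \oo --> L x},
          (fun n => second_moment P (fun x =>
             (n%:R `^ elephant_delta m p q)^-1 *: position X n x - L x))
               @ \oo --> 0%E
        & [/\ forall i : 'I_d, ('E_P[fun x => L x ord0 i] = 0)%E,
              second_moment P L = C%:E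
            & ~ exists c : 'rV[R]_d, {ae P, forall x, L x = c}]].
Proof.
have [_ _ VoE _ Voe] := hV.
exists (limit_constant Vo Ve m p q); split; first exact: limit_constant_gt0.
move=> disp Omega P X U G walk; split; first exact: (variance_asymp _ _ _ _ _ _ _ _ walk).
exists (limit_vector Vo m p q X); split.
- exact: (limit_vector_measurable walk).
- exact: (scaled_cvg _ _ _ _ _ _ _ _ walk).
- exact: (scaled_mean_square_cvg _ _ _ _ _ _ _ _ walk).
split.
- exact: (limit_vector_expectation _ _ _ _ _ _ _ _ walk).
- exact: (limit_vector_second_moment _ _ _ _ _ _ _ _ walk).
- exact: (limit_vector_not_constant _ _ _ _ _ _ _ _ walk).
Qed.
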